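(* Let $n\ge 1$ and let $V=\{(z_1,\dots,z_n)\in\mathbb{C}^n\mid z_1+\dots+z_n=0\}$ be the reflection representation of the symmetric group $\mathfrak{S}_n$ (acting by permutation of coordinates). Then the representation ring $R(\mathfrak{S}_n)$ is generated, as a ring, by the classes of the exterior powers $\Lambda^kV$ for $0\le k\le n-1$.
   Context: $R(\mathfrak{S}_n)$ is the ring (over $\mathbb{Z}$) of virtual finite-dimensional complex representations of $\mathfrak{S}_n$, with addition induced by direct sum and multiplication induced by tensor product. In terms of partitions, $V=V_{[n-1,1]}$ and $\Lambda^kV=V_{[n-k,1^k]}$. *)

(* Defs.v *)
From HB Require Import structures.
From mathcomp Require Import all_boot all_order all_algebra all_fingroup.
From mathcomp Require Import generic_quotient mxrepresentation character.
From mathcomp Require Import boolp reals complex ring.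

Set Implicit Arguments.
Unset Strict Implicit.
Unset Printing Implicit Defensive.

Import GRing.Theory.
Local Open Scope ring_scope.
Local Open Scope quotient_scope.

(* S is boolean-valued, hence an arbitrary subset only by classical logic.    *)
Definition generates_ring (A : pzRingType) (X : A -> Prop) : Prop :=
  forall S : {pred A}, subring_closed S -> (forall x, X x -> x \in S) ->
  forall x, x \in S.

(* Grothendieck ring of a commutative semiring: formal differences p.1 - p.2, *)
(* where the witness z accounts for the possible failure of cancellation.     *)
Section Grothendieck.

Variable S : comPzSemiRingType.
Implicit Types (p q r : S * S) (x y z : S).

Definition groth_rel : rel (S * S) :=
  fun p q => `[< exists z, p.1 + q.2 + z = q.1 + p.2 + z >].

Lemma groth_relP p q :
  reflect (exists z, p.1 + q.2 + z = q.1 + p.2 + z) (groth_rel p q).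
Proof. exact: asboolP. Qed.

Lemma groth_refl : reflexive groth_rel.
Proof. by move=> p; apply/groth_relP; exists 0. Qed.

Lemma groth_sym : symmetric groth_rel.
Proof. by move=> p q; apply/groth_relP/groth_relP=> -[z Hz]; exists z. Qed.

Lemma groth_trans : transitive groth_rel.
Proof.
move=> q p r /groth_relP[z Hz] /groth_relP[t Ht]; apply/groth_relP.
exists (q.1 + q.2 + z + t).
transitivity ((p.1 + q.2 + z) + (q.1 + r.2 + t)); first by ring.
by rewrite Hz Ht; ring.
Qed.

Canonical groth_equiv := EquivRel groth_rel groth_refl groth_sym groth_trans.

Definition grothendieck := {eq_quot groth_rel}.

HB.instance Definition _ : EqQuotient _ groth_rel grothendieck :=
  EqQuotient.on grothendieck.
HB.instance Definition _ := Choice.on grothendieck.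

Lemma groth_eqP p q :
  reflect (exists z, p.1 + q.2 + z = q.1 + p.2 + z)
          (\pi_grothendieck p == \pi_grothendieck q).
Proof. by rewrite eqmodE; apply: groth_relP. Qed.

Let addp p q : S * S := (p.1 + q.1, p.2 + q.2).
Let oppp p : S * S := (p.2, p.1).
Let mulp p q : S * S := (p.1 * q.1 + p.2 * q.2, p.1 * q.2 + p.2 * q.1).

Definition groth_zero : grothendieck := \pi_grothendieck (0, 0).
Definition groth_one : grothendieck := \pi_grothendieck (1, 0).
Definition groth_add (a b : grothendieck) : grothendieck :=
  \pi_grothendieck (addp (repr a) (repr b)).
Definition groth_opp (a : grothendieck) : grothendieck :=
  \pi_grothendieck (oppp (repr a)).
Definition groth_mul (a b : grothendieck) : grothendieck :=
  \pi_grothendieck (mulp (repr a) (repr b)).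

Let reprP p : exists z,
  (repr (\pi_grothendieck p)).1 + p.2 + z =
  p.1 + (repr (\pi_grothendieck p)).2 + z.
Proof. by apply/groth_eqP; rewrite reprK. Qed.

Let addE p q : groth_add (\pi p) (\pi q) = \pi_grothendieck (addp p q).
Proof.
rewrite /groth_add; have [z Hz] := reprP p; have [t Ht] := reprP q.
move: (repr _) (repr _) Hz Ht => q' p' Hz Ht.
apply/eqP/groth_eqP; exists (z + t) => /=.
transitivity ((p'.1 + p.2 + z) + (q'.1 + q.2 + t)); first by ring.
by rewrite Hz Ht; ring.
Qed.

Let oppE p : groth_opp (\pi p) = \pi_grothendieck (oppp p).
Proof.
rewrite /groth_opp; have [z Hz] := reprP p; move: (repr _) Hz => p' Hz.
apply/eqP/groth_eqP; exists z => /=.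
transitivity (p.1 + p'.2 + z); first by ring.
by rewrite -Hz; ring.
Qed.

Let mulE p q : groth_mul (\pi p) (\pi q) = \pi_grothendieck (mulp p q).
Proof.
rewrite /groth_mul; have [z Hz] := reprP p; have [t Ht] := reprP q.
move: (repr _) (repr _) Hz Ht => q' p' Hz Ht.
transitivity (\pi_grothendieck (mulp p q')); apply/eqP/groth_eqP => /=.
  exists (z * q'.1 + z * q'.2).
  transitivity ((p'.1 + p.2 + z) * q'.1 + (p.1 + p'.2 + z) * q'.2).
    by ring.
  by rewrite -Hz [in X in X + _]Hz; ring.
exists (p.1 * t + p.2 * t).
transitivity (p.1 * (q'.1 + q.2 + t) + p.2 * (q.1 + q'.2 + t)).
  by ring.
by rewrite -Ht [in X in X + _]Ht; ring.
Qed.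

Let pi_eq p q : p.1 = q.1 -> p.2 = q.2 -> \pi_grothendieck p = \pi q.
Proof. by case: p q => [? ?] [? ?] /= -> ->. Qed.

Let addA : associative groth_add.
Proof.
elim/quotW=> p; elim/quotW=> q; elim/quotW=> r; rewrite !addE.
by apply: pi_eq => /=; ring.
Qed.

Let addC : commutative groth_add.
Proof.
by elim/quotW=> p; elim/quotW=> q; rewrite !addE; apply: pi_eq => /=; ring.
Qed.

Let add0 : left_id groth_zero groth_add.
Proof. by elim/quotW=> p; rewrite addE; apply: pi_eq => /=; ring. Qed.

Let addN : left_inverse groth_zero groth_opp groth_add.
Proof.
elim/quotW=> p; rewrite oppE addE; apply/eqP/groth_eqP; exists 0 => /=.
by ring.
Qed.

HB.instance Definition _ :=
  GRing.isZmodule.Build grothendieck addA addC add0 addN.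

Let mulA : associative groth_mul.
Proof.
elim/quotW=> p; elim/quotW=> q; elim/quotW=> r; rewrite !mulE.
by apply: pi_eq => /=; ring.
Qed.

Let mulC : commutative groth_mul.
Proof.
by elim/quotW=> p; elim/quotW=> q; rewrite !mulE; apply: pi_eq => /=; ring.
Qed.

Let mul1 : left_id groth_one groth_mul.
Proof. by elim/quotW=> p; rewrite mulE; apply: pi_eq => /=; ring. Qed.

Let mulDl : left_distributive groth_mul groth_add.
Proof.
elim/quotW=> p; elim/quotW=> q; elim/quotW=> r; rewrite addE !mulE addE.
by apply: pi_eq => /=; ring.
Qed.

HB.instance Definition _ :=
  GRing.Zmodule_isComPzRing.Build grothendieck mulA mulC mul1 mulDl.

Definition to_groth (x : S) : grothendieck := \pi_grothendieck (x, 0).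

Lemma to_grothP x y :
  reflect (exists z, x + z = y + z) (to_groth x == to_groth y).
Proof.
by apply: (iffP (groth_eqP _ _)) => -[z /= Hz]; exists z;
  rewrite ?addr0 in Hz *.
Qed.

Lemma to_groth0 : to_groth 0 = 0. Proof. by []. Qed.

Lemma to_groth1 : to_groth 1 = 1. Proof. by []. Qed.

Lemma to_grothD : {morph to_groth : x y / x + y}.
Proof. by move=> x y; rewrite [RHS]addE; apply: pi_eq => /=; ring. Qed.

Lemma to_grothM : {morph to_groth : x y / x * y}.
Proof. by move=> x y; rewrite [RHS]mulE; apply: pi_eq => /=; ring. Qed.

Lemma groth_diff (a : grothendieck) : exists x y, a = to_groth x - to_groth y.
Proof.
elim/quotW: a => -[x y]; exists x, y.
rewrite [X in _ + X]oppE [RHS]addE.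
by apply: pi_eq; rewrite /= ?addr0 ?add0r.
Qed.

End Grothendieck.

(* Row-major indexing of the basis of a tensor product, as used by tprod. *)
Fixpoint tindex m n : 'I_m -> 'I_n -> 'I_(m * n) :=
  match m return 'I_m -> 'I_n -> 'I_(m * n) with
  | 0 => fun i _ => False_rect _ (notF (ltn_ord i))
  | m'.+1 => fun i j =>
      match @split 1 m' i with
      | inl _ => lshift (m' * n) j
      | inr i' => rshift n (tindex i' j)
      end
  end.

Lemma tindex_inj m n (i i' : 'I_m) (j j' : 'I_n) :
  tindex i j = tindex i' j' -> i = i' /\ j = j'.
Proof.
elim: m i i' => [[]//|m IH] i i' /=.
have := @splitK 1 m i; have := @splitK 1 m i'.
case: (@split 1 m i) (@split 1 m i') => [k|k] [k'|k'] /= <- <-.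
- by move/lshift_inj->; rewrite (ord1 k) (ord1 k').
- by move/eqP; rewrite eq_lrshift.
- by move/eqP; rewrite eq_rlshift.
- by move/rshift_inj/IH => [-> ->].
Qed.

Lemma trowE (F : fieldType) n1 (A : 'rV[F]_n1) m2 n2 (B : 'M_(m2, n2)) i j k :
  trow A B i (tindex j k) = A 0 j * B i k.
Proof.
elim: n1 A j => [?[]//|n1 IH] A j /=.
have := @splitK 1 n1 j; case: (@split 1 n1 j) => j' /= <-.
  by rewrite row_mxEl !mxE (ord1 j').
by rewrite row_mxEr IH mxE.
Qed.

Lemma tprod_tindex (F : fieldType) m1 n1 (A : 'M[F]_(m1, n1))
    m2 n2 (B : 'M[F]_(m2, n2)) i j k l :
  tprod A B (tindex i j) (tindex k l) = A i k * B j l.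
Proof.
elim: m1 A i => [?[]//|m1 IH] A i /=.
have := @splitK 1 m1 i; case: (@split 1 m1 i) => i' /= <-.
  by rewrite col_mxEu trowE mxE (ord1 i').
by rewrite col_mxEd IH mxE.
Qed.

HB.instance Definition _ (F : fieldType) (gT : finGroupType) (G : {group gT}) :=
  gen_eqMixin (representation F G).
HB.instance Definition _ (F : fieldType) (gT : finGroupType) (G : {group gT}) :=
  gen_choiceMixin (representation F G).

Section IsoClasses.

Variables (F : fieldType) (gT : finGroupType) (G : {group gT}).
Local Notation rep := (representation F G).
Implicit Types (A B C D : rep).

Lemma rsim_reindex (I : finType) A B
    (e : I -> 'I_(rdegree A)) (f : I -> 'I_(rdegree B)) :
    injective e -> injective f -> #|I| = rdegree A -> #|I| = rdegree B ->
    (forall x i j, x \in G -> A x (e i) (e j) = B x (f i) (f j)) ->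
  mx_rsim A B.
Proof.
move=> einj finj cA cB AB.
have [e' eK e'K] : bijective e by apply: inj_card_bij; rewrite // card_ord cA.
have [f' fK f'K] : bijective f by apply: inj_card_bij; rewrite // card_ord cB.
pose P : 'M[F]_(rdegree A, rdegree B) := \matrix_(i, j) (f (e' i) == j)%:R.
exists P; first by rewrite -cA.
  apply/row_freeP; exists (\matrix_(j, i) (f (e' i) == j)%:R).
  apply/matrixP=> i k; rewrite !mxE (bigD1 (f (e' i))) //= !mxE eqxx mul1r.
  rewrite big1 ?addr0 => [|j]; last first.
    by rewrite !mxE eq_sym => /negPf->; rewrite mul0r.
  by rewrite (inj_eq finj) (inj_eq (can_inj e'K)) eq_sym.
move=> x Gx; apply/matrixP=> i j; rewrite !mxE.
rewrite (bigD1 (e (f' j))) //= mxE eK f'K eqxx mulr1.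
rewrite big1 ?addr0 => [|k]; last first.
  move=> ne; rewrite mxE; case: eqP => [Ej|_]; last by rewrite mulr0.
  by rewrite -Ej fK e'K eqxx in ne.
rewrite (bigD1 (f (e' i))) //= mxE eqxx mul1r big1 ?addr0 => [|k]; last first.
  by rewrite mxE eq_sym => /negPf->; rewrite mul0r.
by rewrite -{1}[(i)]e'K AB // f'K.
Qed.

Definition iso_rel : rel rep := fun A B => `[< mx_rsim A B >].

Lemma iso_relP A B : reflect (mx_rsim A B) (iso_rel A B).
Proof. exact: asboolP. Qed.

Lemma iso_refl : reflexive iso_rel.
Proof. by move=> A; apply/iso_relP/mx_rsim_refl. Qed.

Lemma iso_sym : symmetric iso_rel.
Proof. by move=> A B; apply/iso_relP/iso_relP=> /mx_rsim_sym. Qed.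

Lemma iso_trans : transitive iso_rel.
Proof.
by move=> B A C /iso_relP AB /iso_relP /(mx_rsim_trans AB) AC; apply/iso_relP.
Qed.

Canonical iso_equiv := EquivRel iso_rel iso_refl iso_sym iso_trans.

Definition iso_class := {eq_quot iso_rel}.

HB.instance Definition _ : EqQuotient _ iso_rel iso_class :=
  EqQuotient.on iso_class.
HB.instance Definition _ := Choice.on iso_class.

Lemma iso_classP A B :
  reflect (mx_rsim A B) (\pi_iso_class A == \pi_iso_class B).
Proof. by rewrite eqmodE; apply: iso_relP. Qed.

Lemma triv_mx_repr : mx_repr G (fun _ : gT => 1%:M : 'M[F]_1).
Proof. by split=> // x y _ _; rewrite mulmx1. Qed.

Definition triv_grepr : rep := Representation (MxRepresentation triv_mx_repr).
Definition prod_grepr A B : rep := Representation (prod_repr A B).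

Definition iso_add (a b : iso_class) : iso_class :=
  \pi_iso_class (dadd_grepr (repr a) (repr b)).
Definition iso_mul (a b : iso_class) : iso_class :=
  \pi_iso_class (prod_grepr (repr a) (repr b)).

Lemma rsim_dadd A B C D :
  mx_rsim A C -> mx_rsim B D -> mx_rsim (dadd_grepr A B) (dadd_grepr C D).
Proof.
case=> P dAC /row_freeP[P' PK] hP [Q dBD /row_freeP[Q' QK] hQ].
exists (block_mx P 0 0 Q); first by rewrite /= dAC dBD.
  apply/row_freeP; exists (block_mx P' 0 0 Q').
  by rewrite mulmx_block !(mulmx0, mul0mx, addr0, add0r) PK QK -scalar_mx_block.
move=> x Gx /=; rewrite !mulmx_block !(mulmx0, mul0mx, addr0, add0r).
by rewrite hP // hQ.
Qed.

Lemma rsim_prod A B C D :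
  mx_rsim A C -> mx_rsim B D -> mx_rsim (prod_grepr A B) (prod_grepr C D).
Proof.
case=> P dAC /row_freeP[P' PK] hP [Q dBD /row_freeP[Q' QK] hQ].
exists (tprod P Q); first by rewrite /= dAC dBD.
  by apply/row_freeP; exists (tprod P' Q'); rewrite -tprodE PK QK tprod1.
by move=> x Gx /=; rewrite -!tprodE hP // hQ.
Qed.

Lemma iso_addE A B :
  iso_add (\pi_iso_class A) (\pi_iso_class B) = \pi_iso_class (dadd_grepr A B).
Proof.
by apply/eqP/iso_classP/rsim_dadd; apply/iso_classP; rewrite reprK.
Qed.

Lemma iso_mulE A B :
  iso_mul (\pi_iso_class A) (\pi_iso_class B) = \pi_iso_class (prod_grepr A B).
Proof.
by apply/eqP/iso_classP/rsim_prod; apply/iso_classP; rewrite reprK.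
Qed.

Let iso_addA : associative iso_add.
Proof.
elim/quotW=> A; elim/quotW=> B; elim/quotW=> C.
rewrite (iso_addE B) (iso_addE A B) !iso_addE.
apply/eqP/iso_classP.
pose I : finType := ('I_(rdegree A) + ('I_(rdegree B) + 'I_(rdegree C)))%type.
pose e (u : I) : 'I_(rdegree (dadd_grepr A (dadd_grepr B C))) :=
  match u with
  | inl i => lshift _ i
  | inr (inl i) => rshift _ (lshift _ i)
  | inr (inr i) => rshift _ (rshift _ i)
  end.
pose f (u : I) : 'I_(rdegree (dadd_grepr (dadd_grepr A B) C)) :=
  match u with
  | inl i => lshift _ (lshift _ i)
  | inr (inl i) => lshift _ (rshift _ i)
  | inr (inr i) => rshift _ i
  end.
apply: (rsim_reindex (e := e) (f := f)).
- by move=> [i|[i|i]] [j|[j|j]] /eqP; rewrite /e /=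
    ?eq_lshift ?eq_rshift ?eq_lrshift ?eq_rlshift ?eq_lshift ?eq_rshift
    ?eq_lrshift ?eq_rlshift // => /eqP->.
- by move=> [i|[i|i]] [j|[j|j]] /eqP; rewrite /f /=
    ?eq_lshift ?eq_rshift ?eq_lrshift ?eq_rlshift ?eq_lshift ?eq_rshift
    ?eq_lrshift ?eq_rlshift // => /eqP->.
- by rewrite !card_sum !card_ord.
- by rewrite !card_sum !card_ord /= addnA.
by move=> x [i|[i|i]] [j|[j|j]] Gx; rewrite /e /f /=
  ?(block_mxEul, block_mxEur, block_mxEdl, block_mxEdr) ?mxE
  ?(block_mxEul, block_mxEur, block_mxEdl, block_mxEdr) ?mxE.
Qed.

Let iso_addC : commutative iso_add.
Proof.
elim/quotW=> A; elim/quotW=> B; rewrite !iso_addE; apply/eqP/iso_classP.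
pose I : finType := ('I_(rdegree A) + 'I_(rdegree B))%type.
pose e (u : I) : 'I_(rdegree (dadd_grepr A B)) :=
  match u with inl i => lshift _ i | inr i => rshift _ i end.
pose f (u : I) : 'I_(rdegree (dadd_grepr B A)) :=
  match u with inl i => rshift _ i | inr i => lshift _ i end.
apply: (rsim_reindex (e := e) (f := f)).
- by move=> [i|i] [j|j] /eqP; rewrite /e
    ?eq_lshift ?eq_rshift ?eq_lrshift ?eq_rlshift // => /eqP->.
- by move=> [i|i] [j|j] /eqP; rewrite /f
    ?eq_lshift ?eq_rshift ?eq_lrshift ?eq_rlshift // => /eqP->.
- by rewrite !card_sum !card_ord.
- by rewrite !card_sum !card_ord /= addnC.
by move=> x [i|i] [j|j] Gx; rewrite /e /f /=
  ?(block_mxEul, block_mxEur, block_mxEdl, block_mxEdr) ?mxE.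
Qed.

Let iso_add0 : left_id (\pi_iso_class grepr0) iso_add.
Proof.
elim/quotW=> A; rewrite !iso_addE; apply/eqP/iso_classP.
apply: (@rsim_reindex 'I_(rdegree A) (dadd_grepr grepr0 A) A
          (@rshift 0 (rdegree A)) id) => //.
- exact: rshift_inj.
- by rewrite card_ord.
- by rewrite card_ord.
by move=> x i j Gx; rewrite /= block_mxEdr.
Qed.

HB.instance Definition _ :=
  GRing.isNmodule.Build iso_class iso_addA iso_addC iso_add0.

Let iso_mulA : associative iso_mul.
Proof.
elim/quotW=> A; elim/quotW=> B; elim/quotW=> C.
rewrite (iso_mulE B) (iso_mulE A B) !iso_mulE.
apply/eqP/iso_classP.
pose I : finType := ('I_(rdegree A) * 'I_(rdegree B) * 'I_(rdegree C))%type.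
apply: (@rsim_reindex I (prod_grepr A (prod_grepr B C))
          (prod_grepr (prod_grepr A B) C)
          (fun u => tindex u.1.1 (tindex u.1.2 u.2))
          (fun u => tindex (tindex u.1.1 u.1.2) u.2)).
- by move=> [[i j] k] [[i' j'] k'] /= /tindex_inj[-> /tindex_inj[-> ->]].
- by move=> [[i j] k] [[i' j'] k'] /= /tindex_inj[/tindex_inj[-> ->] ->].
- by rewrite !card_prod !card_ord /= mulnA.
- by rewrite !card_prod !card_ord.
by move=> x [[i j] k] [[i' j'] k'] Gx; rewrite /= !tprod_tindex mulrA.
Qed.

Let iso_mulC : commutative iso_mul.
Proof.
elim/quotW=> A; elim/quotW=> B; rewrite !iso_mulE; apply/eqP/iso_classP.
pose I : finType := ('I_(rdegree A) * 'I_(rdegree B))%type.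
apply: (@rsim_reindex I (prod_grepr A B) (prod_grepr B A)
          (fun u => tindex u.1 u.2) (fun u => tindex u.2 u.1)).
- by move=> [i j] [i' j'] /= /tindex_inj[-> ->].
- by move=> [i j] [i' j'] /= /tindex_inj[-> ->].
- by rewrite !card_prod !card_ord.
- by rewrite !card_prod !card_ord /= mulnC.
by move=> x [i j] [i' j'] Gx; rewrite /= !tprod_tindex mulrC.
Qed.

Let iso_mul1 : left_id (\pi_iso_class triv_grepr) iso_mul.
Proof.
elim/quotW=> A; rewrite !iso_mulE; apply/eqP/iso_classP.
apply: (@rsim_reindex 'I_(rdegree A) (prod_grepr triv_grepr A) A
          (fun i => tindex (ord0 : 'I_1) i) id) => //.
- by move=> i j /tindex_inj[].
- by rewrite card_ord /= mul1n.
- by rewrite card_ord.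
by move=> x i j Gx; rewrite [LHS]tprod_tindex mxE eqxx mul1r.
Qed.

Let iso_mulDl : left_distributive iso_mul iso_add.
Proof.
elim/quotW=> A; elim/quotW=> B; elim/quotW=> C.
rewrite (iso_addE A) (iso_mulE A) (iso_mulE B) iso_mulE iso_addE.
apply/eqP/iso_classP.
pose I : finType :=
  ('I_(rdegree A) * 'I_(rdegree C) + 'I_(rdegree B) * 'I_(rdegree C))%type.
pose e (u : I) : 'I_(rdegree (prod_grepr (dadd_grepr A B) C)) :=
  match u with
  | inl p => tindex (lshift (rdegree B) p.1) p.2
  | inr p => tindex (rshift (rdegree A) p.1) p.2
  end.
pose f (u : I) :
    'I_(rdegree (dadd_grepr (prod_grepr A C) (prod_grepr B C))) :=
  match u with
  | inl p => lshift (rdegree B * rdegree C) (tindex p.1 p.2)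
  | inr p => rshift (rdegree A * rdegree C) (tindex p.1 p.2)
  end.
apply: (rsim_reindex (e := e) (f := f)).
- move=> [[i j]|[i j]] [[i' j']|[i' j']] /= /tindex_inj[].
  + by move/lshift_inj=> -> ->.
  + by move/eqP; rewrite eq_lrshift.
  + by move/eqP; rewrite eq_rlshift.
  + by move/rshift_inj=> -> ->.
- move=> [[i j]|[i j]] [[i' j']|[i' j']] /=.
  + by move/lshift_inj/tindex_inj=> [-> ->].
  + by move/eqP; rewrite eq_lrshift.
  + by move/eqP; rewrite eq_rlshift.
  + by move/rshift_inj/tindex_inj=> [-> ->].
- by rewrite card_sum !card_prod !card_ord /= mulnDl.
- by rewrite card_sum !card_prod !card_ord.
by move=> x [[i j]|[i j]] [[i' j']|[i' j']] Gx; rewrite /= tprod_tindex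
  ?(block_mxEul, block_mxEur, block_mxEdl, block_mxEdr)
  ?tprod_tindex ?mxE ?mul0r.
Qed.

Let iso_mul0 : left_zero (\pi_iso_class grepr0) iso_mul.
Proof.
elim/quotW=> A; rewrite iso_mulE; apply/eqP/iso_classP.
apply: (@rsim_reindex 'I_0 (prod_grepr grepr0 A) grepr0
          (widen_ord (leq0n _)) id) => //.
- by move=> [].
- by rewrite card_ord.
- by rewrite card_ord.
by move=> x [].
Qed.

HB.instance Definition _ := GRing.Nmodule_isComPzSemiRing.Build iso_class
  iso_mulA iso_mulC iso_mul1 iso_mulDl iso_mul0.

Definition rep_ring := grothendieck iso_class.
HB.instance Definition _ := GRing.ComPzRing.on rep_ring.

Definition rep_class A : rep_ring := to_groth (\pi_iso_class A).

Lemma rep_classP A B :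
  reflect (exists C, mx_rsim (dadd_grepr A C) (dadd_grepr B C))
          (rep_class A == rep_class B).
Proof.
apply: (iffP (to_grothP _ _)) => [[]|[C AB]].
  elim/quotW=> C; rewrite /GRing.add /= !iso_addE => /eqP/iso_classP AB.
  by exists C.
exists (\pi_iso_class C); rewrite /GRing.add /= !iso_addE.
exact/eqP/iso_classP.
Qed.

Lemma rep_class0 : rep_class grepr0 = 0. Proof. by []. Qed.

Lemma rep_class1 : rep_class triv_grepr = 1. Proof. by []. Qed.

Lemma rep_classD A B : rep_class (dadd_grepr A B) = rep_class A + rep_class B.
Proof. by rewrite -to_grothD /rep_class -iso_addE. Qed.

Lemma rep_classM A B : rep_class (prod_grepr A B) = rep_class A * rep_class B.
Proof. by rewrite -to_grothM /rep_class -iso_mulE. Qed.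

Lemma rep_ringP (a : rep_ring) : exists A B, a = rep_class A - rep_class B.
Proof.
have [x [y ->]] := groth_diff a.
by elim/quotW: x => A; elim/quotW: y => B; exists A, B.
Qed.

Let rep_one_neq0 : 1 != 0 :> rep_ring.
Proof.
apply/negP=> /rep_classP[C] /mxrank_rsim /= /eqP.
by rewrite -[X in _ == X]add0n eqn_add2r.
Qed.

HB.instance Definition _ :=
  GRing.PzSemiRing_isNonZero.Build rep_ring rep_one_neq0.

End IsoClasses.

(* Coordinates, in the basis e_(t_0) /\ ... /\ e_(t_(k-1)) (t increasing) of  *)
(* the k-th exterior power, of the wedge of the k rows of M. The k-th         *)
(* exterior power of the map u |-> u *m A is then ext_mx k A, by wedge_mulmx. *)
Section ExteriorPower.

Variable F : fieldType.

Definition ext_basis k d : {set k.-tuple 'I_d} :=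
  [set t : k.-tuple 'I_d | sorted ltn (map val t)].

Definition wedge k d (M : 'M[F]_(k, d)) : 'rV[F]_#|ext_basis k d| :=
  \row_j \det (colsub (tnth (enum_val j)) M).

Definition ext_mx k d (A : 'M[F]_d) : 'M[F]_#|ext_basis k d| :=
  \matrix_(i, j) \det (mxsub (tnth (enum_val i)) (tnth (enum_val j)) A).

Lemma card_ext_basis k d : #|ext_basis k d| = 'C(d, k).
Proof. exact: card_ltn_sorted_tuples. Qed.

Lemma row_ext_mx k d (A : 'M[F]_d) i :
  row i (ext_mx k A) = wedge (rowsub (tnth (enum_val i)) A).
Proof.
apply/rowP=> j; rewrite !mxE; congr (\det _).
by apply/matrixP=> a b; rewrite !mxE.
Qed.

Lemma ext_basis_uniq k d (t : k.-tuple 'I_d) : t \in ext_basis k d -> uniq t.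
Proof.
rewrite inE => st; rewrite -(map_inj_uniq val_inj).
exact: (sorted_uniq ltn_trans ltnn).
Qed.

Lemma tnth_ext_basis_inj k d (t : k.-tuple 'I_d) :
  t \in ext_basis k d -> injective (tnth t).
Proof. by move/ext_basis_uniq/tuple_uniqP. Qed.

Lemma ext_basis_eq k d (t u : k.-tuple 'I_d) :
  t \in ext_basis k d -> u \in ext_basis k d -> {subset t <= u} -> t = u.
Proof.
move=> Bt Bu tu; have {}tu : t =i u.
  by apply: (uniq_min_size (ext_basis_uniq Bt) tu _).2; rewrite !size_tuple.
apply/val_inj/(inj_map val_inj).
apply: (irr_sorted_eq ltn_trans ltnn); rewrite !inE in Bt Bu => // x.
by apply/mapP/mapP=> -[y yP ->]; exists y; rewrite // ?tu // -tu.
Qed.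

Lemma sort_ffun k d (f : 'I_k -> 'I_d) : injective f ->
  exists2 t, t \in ext_basis k d & exists s : 'S_k, f =1 tnth t \o s.
Proof.
move=> finj; pose c := [tuple f i | i < k].
have sz : size (sort (relpre val leq) c) == k by rewrite size_sort size_tuple.
exists (Tuple sz).
  rewrite inE ltn_sorted_uniq_leq (map_inj_uniq val_inj) sort_uniq.
  rewrite map_inj_uniq ?enum_uniq //= sorted_map sort_sorted //.
have /tuple_permP[s cE] : perm_eq c (Tuple sz) by rewrite perm_sym perm_sort.
exists s => i.
have {}cE : c = [tuple tnth (Tuple sz) (s j) | j < k] by apply: val_inj.
by have := congr1 (fun u => tnth u i) cE; rewrite /= !tnth_mktuple.
Qed.

Lemma det_mulmx_ffun k d (M : 'M[F]_(k, d)) (B : 'M[F]_(d, k)) :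
  \det (M *m B) =
  \sum_(f : {ffun 'I_k -> 'I_d}) (\prod_i M i (f i)) * \det (rowsub f B).
Proof.
transitivity (\sum_(s : 'S_k) \sum_(f : {ffun 'I_k -> 'I_d})
    (-1) ^+ s * \prod_i (M i (f i) * B (f i) (s i))).
  apply: eq_bigr => s _; rewrite -big_distrr.
  rewrite -(bigA_distr_bigA (fun i j => M i j * B j (s i))); congr (_ * _).
  by apply: eq_bigr => i _; rewrite mxE.
rewrite exchange_big; apply: eq_bigr => f _; rewrite big_distrr /=.
apply: eq_bigr => s _; rewrite big_split mulrCA; congr (_ * (_ * _)).
by apply: eq_bigr => i _; rewrite mxE.
Qed.

Lemma cauchy_binet k d (M : 'M[F]_(k, d)) (B : 'M[F]_(d, k)) :
  \det (M *m B) = \sum_(t in ext_basis k d)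
    \det (colsub (tnth t) M) * \det (rowsub (tnth t) B).
Proof.
rewrite det_mulmx_ffun (bigID (fun f : {ffun _} => injectiveb f)) /=.
rewrite [X in _ + X]big1 ?addr0 => [|f /injectivePn[i [j ne fE]]]; last first.
  by rewrite (@determinant_alternate _ _ _ i j) ?mulr0 // => l; rewrite !mxE fE.
pose h (p : k.-tuple 'I_d * 'S_k) := [ffun i => tnth p.1 (p.2 i)].
pose A := setX (ext_basis k d) [set: 'S_k].
have hinj : {in A &, injective h}.
  move=> [t s] [u r]; rewrite !in_setX !in_setT !andbT /= => Bt Bu /ffunP tu.
  have E : t = u.
    apply: ext_basis_eq => // x /tnthP[i ->].
    by have := tu (s^-1%g i); rewrite !ffunE /= permKV => ->; apply: mem_tnth.
  rewrite -{}E in tu *; congr (_, _); apply/permP=> i.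
  by have := tu i; rewrite !ffunE /=; apply: tnth_ext_basis_inj.
rewrite (eq_bigl (mem (h @: A))) => [|f]; last first.
  apply/injectiveP/imsetP=> [/sort_ffun[t Bt [s fE]] | [[t s]]].
    exists (t, s); first by rewrite in_setX Bt in_setT.
    by apply/ffunP=> i; rewrite fE ffunE.
  rewrite in_setX in_setT andbT /= => Bt -> i j; rewrite !ffunE /=.
  by move/(tnth_ext_basis_inj Bt)/perm_inj.
rewrite (big_imset _ hinj) /=.
rewrite (eq_bigl (fun p => (p.1 \in ext_basis k d) && true)); last first.
  by move=> [t s]; rewrite in_setX in_setT.
rewrite -(pair_big (mem (ext_basis k d)) xpredT (fun t (s : 'S_k) =>
  \prod_i M i (h (t, s) i) * \det (rowsub (h (t, s)) B))) /=.
apply: eq_bigr => t Bt; rewrite big_distrl; apply: eq_bigr => s _ /=.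
have -> : rowsub (h (t, s)) B = row_perm s (rowsub (tnth t) B).
  by apply/matrixP=> i j; rewrite !mxE ffunE.
rewrite row_permE det_mulmx det_perm mulrA [_ * (-1) ^+ _]mulrC.
by congr (_ * _ * _); apply: eq_bigr => i _; rewrite mxE ffunE.
Qed.

Lemma wedge_mulmx k d (M : 'M[F]_(k, d)) (A : 'M[F]_d) :
  wedge (M *m A) = wedge M *m ext_mx k A.
Proof.
apply/rowP=> j; rewrite !mxE; rewrite -mulmx_colsub cauchy_binet.
rewrite (reindex_onto (@enum_val _ _) (enum_rank_in (enum_valP j))) => [|t Bt].
  rewrite /=; apply: eq_big => [i|i _].
    by rewrite enum_valP enum_valK_in eqxx.
  rewrite !mxE; congr (_ * \det _).
  by apply/matrixP=> ? ?; rewrite !mxE.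
by rewrite enum_rankK_in.
Qed.

Lemma ext_mx1 k d : ext_mx k (1%:M : 'M[F]_d) = 1%:M.
Proof.
apply/matrixP=> i j; rewrite !mxE; case: eqP => [<-|ne].
  rewrite -[RHS](det1 _ k); congr (\det _); apply/matrixP=> a b.
  by rewrite !mxE (inj_eq (tnth_ext_basis_inj (enum_valP i))).
have [tu|/allPn[x /tnthP[a ->] xu]] :=
    boolP (all [in enum_val j] (enum_val i : k.-tuple 'I_d)).
  by case: ne; apply/enum_val_inj/ext_basis_eq/allP; rewrite ?enum_valP.
rewrite (expand_det_row _ a) big1 // => b _; rewrite !mxE.
case: eqP => [E|_]; last by rewrite mul0r.
by rewrite E mem_tnth in xu.
Qed.

Lemma ext_mxM k d (A B : 'M[F]_d) :
  ext_mx k (A *m B) = ext_mx k A *m ext_mx k B.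
Proof.
apply/row_matrixP=> i; rewrite row_mul !row_ext_mx -wedge_mulmx.
by rewrite mul_rowsub_mx.
Qed.

Variables (gT : finGroupType) (G : {group gT}).

Lemma ext_mx_repr k (A : representation F G) :
  mx_repr G (fun x => ext_mx k (A x)).
Proof.
split=> [|x y Gx Gy]; first by rewrite repr_mx1 ext_mx1.
by rewrite repr_mxM // ext_mxM.
Qed.

Definition ext_grepr k (A : representation F G) : representation F G :=
  Representation (MxRepresentation (ext_mx_repr k A)).

End ExteriorPower.

Section Reflection.

Variables (F : fieldType) (n : nat).

(* mathcomp composes permutations left to right, matching the right action on *)
(* row vectors: (v *m perm_mx s) 0 (s i) = v 0 i.                             *)
Lemma perm_mx_is_repr :
  mx_repr [set: 'S_n]%G (fun s : 'S_n => perm_mx s : 'M[F]_n).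
Proof. by split=> [|s t _ _]; rewrite ?perm_mx1 ?perm_mxM. Qed.

Definition perm_repr := MxRepresentation perm_mx_is_repr.

(* The row space of sum0_mx is {v | v_0 + ... + v_(n-1) = 0}, by sum0_mxP.    *)
Definition sum0_mx : 'M[F]_n := kermx (const_mx 1 : 'cV[F]_n).

Lemma sum0_mxP (v : 'rV[F]_n) :
  reflect (\sum_i v 0 i = 0) (v <= sum0_mx)%MS.
Proof.
have -> : \sum_i v 0 i = (v *m (const_mx 1 : 'cV[F]_n)) 0 0.
  by rewrite mxE; apply: eq_bigr => i _; rewrite mxE mulr1.
rewrite /sum0_mx; apply: (iffP sub_kermxP) => [->|v0]; first by rewrite mxE.
by apply/matrixP=> i j; rewrite !ord1 v0 mxE.
Qed.

Lemma sum0_mxmodule : mxmodule perm_repr sum0_mx.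
Proof.
apply/mxmoduleP=> s _; apply/sub_kermxP; rewrite -mulmxA.
rewrite (_ : perm_repr s *m _ = const_mx 1) ?mulmx_ker //.
by rewrite -row_permE; apply/matrixP=> i j; rewrite !mxE.
Qed.

Definition refl_grepr : representation F [set: 'S_n]%G :=
  Representation (submod_repr sum0_mxmodule).

End Reflection.

(* Main.v *)
Require Import Defs.
From mathcomp Require Import all_boot all_order all_algebra all_fingroup.
From mathcomp Require Import generic_quotient mxrepresentation character.
From mathcomp Require Import boolp reals complex.
From mathcomp Require Import pgroup ring zify.

Set Implicit Arguments.
Unset Strict Implicit.
Unset Printing Implicit Defensive.

Import Order.TTheory GRing.Theory Num.Theory.
Local Open Scope ring_scope.

(** Write P for the permutation representation C^n, V for its reflection
    subrepresentation, and A for a subring of R(S_n) containing every Lambda^k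
    V. In characteristic 0 an element of R(S_n) is determined by its character
    (chi_inj), so that A can be studied as a ring of class functions. The claim
    that A is everything has two halves.

    First, A contains the sign and the permutation characters of S_n on the
    cosets of its Young subgroups. For a polynomial X with integer coefficients
    put [X](s) = prod_C X(u^|C|), the product being over the cycles C of s; this
    is cycle_prod, and it is multiplicative in X. As [1 - u](s) = det (1 - u s |
    P) = (1 - u) det (1 - u s | V), its coefficients are, up to sign, sums of
    characters of exterior powers of V, hence lie in A (cycle_prod_sub1X). A
    power series over A with constant term 1 is invertible, so the X with X(0) =
    1 such that [X] has its coefficients in A are closed under products and
    exact quotients. They include 1 - u^a, obtained from 1 - u by substitution,
    and then 1 + u^a = (1 - u^(2a)) / (1 - u^a). Modulo any power of u, each X
    with X(0) = 1 becomes 1 after multiplication by suitable powers of these, so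
    that every such [X] has its coefficients in A (cycle_prod_poly_char_of).
    Take X = sum_i u^(w_i): then [X](s) is the generating function by weight of
    the colorings of {1, ..., n} that s fixes, and weights w_i that grow fast
    enough record how often each color is used. The coefficients of [X] are then
    the announced permutation characters (char_of_coloring). The leading
    coefficient of [1 - u] yields the sign.

    Second, these characters span. For a coloring c let Y_c be the subgroup
    fixing c. The average over Y_c of a virtual character is an integer, being a
    difference of dimensions of spaces of invariants. The sum over Y_c of the
    sign times the permutation character on colorings of content m counts the
    colorings b of content m which separate the points of equal color under c
    (sum_sign_coloring). Y_c acts freely on them, and its orbits are the
    matrices of zeros and ones whose margins are m and the class sizes of c.
    Hence, by the Gale-Ryser inequalities, this sum vanishes unless the class
    sizes of c are dominated by the partition conjugate to m
    (separates_extremal); in the case of equality the average is 1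
    (card_separates_level). This unitriangularity lets one subtract integer
    multiples of elements of A from a virtual character until all its averages
    over Young subgroups vanish (young_sweep). A class function all of whose
    averages vanish is 0, by induction on the number of cycles (young_sum_eq0). *)

(** * Characters determine the elements of the representation ring *)

Lemma trace_idempotent (F : fieldType) d (P : 'M[F]_d) :
  P *m P = P -> \tr P = (\rank P)%:R.
Proof.
move=> PP; rewrite -[P in LHS]mulmx_base mxtrace_mulC.
suff -> : row_base P *m col_base P = 1%:M by rewrite mxtrace1.
have /row_fullP[C CK] := col_base_full P.
have /row_freeP[R RK] := row_base_free P.
move: (\rank P) (col_base P) (row_base P) (mulmx_base P) C CK R RK.
move=> m c r defP C CK R RK; have : C *m (P *m P) *m R = C *m P *m R by rewrite PP.
by rewrite -defP !mulmxA CK mul1mx -!mulmxA RK !mulmx1 => ->.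
Qed.

Section Characters.

Variables (F : numClosedFieldType) (gT : finGroupType) (G : {group gT}).
Local Notation rep := (representation F G).
Implicit Types (A B : rep) (x y : rep_ring F G).

Lemma pchar'_group : ([pchar F]^'.-group G)%g.
Proof. by rewrite /pgroup pcharf'_nat pnatr_eq0 -lt0n cardG_gt0. Qed.

Lemma rep_class_rsim A B : mx_rsim A B -> rep_class A = rep_class B.
Proof. by move=> AB; congr to_groth; apply/eqP/iso_classP. Qed.

Lemma trace_rsim A B s : s \in G -> mx_rsim A B -> \tr (A s) = \tr (B s).
Proof.
move=> Gs /mx_rsim_def[P [Q PK hP]].
by rewrite hP // mxtrace_mulC mulmxA PK mul1mx.
Qed.

Lemma trace_rep_class A B s :
  s \in G -> rep_class A = rep_class B -> \tr (A s) = \tr (B s).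
Proof.
move=> Gs /eqP/rep_classP[C] /(trace_rsim Gs).
by rewrite !mxtrace_block => /addIr.
Qed.

(** Virtual characters, as functions on the whole group type; only the values on
    G are meaningful. Representatives are chosen, and chi_diff shows that the
    choice is immaterial. *)
Definition chi x (s : gT) : F :=
  let A := sval (cid (rep_ringP x)) in
  let B := sval (cid (svalP (cid (rep_ringP x)))) in
  \tr (A s) - \tr (B s).

Lemma chi_diff A B s :
  s \in G -> chi (rep_class A - rep_class B) s = \tr (A s) - \tr (B s).
Proof.
move=> Gs; rewrite /chi.
case: cid => A' /= ExB; case: cid => B' /= /eqP.
rewrite subr_eq addrAC eq_sym subr_eq -!rep_classD => /eqP/(trace_rep_class Gs).
rewrite !mxtrace_block => E.
by apply/eqP; rewrite subr_eq addrAC eq_sym subr_eq eq_sym E.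
Qed.

Lemma chi_class A s : s \in G -> chi (rep_class A) s = \tr (A s).
Proof.
move=> Gs; rewrite -[rep_class A]subr0 -(rep_class0 F G) chi_diff //=.
by rewrite mxtrace1 subr0.
Qed.

Lemma chiD x y s : s \in G -> chi (x + y) s = chi x s + chi y s.
Proof.
move=> Gs; have [A [B ->]] := rep_ringP x; have [C [D ->]] := rep_ringP y.
rewrite addrACA -opprD -!rep_classD !chi_diff // !mxtrace_block; ring.
Qed.

Lemma chiN x s : s \in G -> chi (- x) s = - chi x s.
Proof.
move=> Gs; have [A [B ->]] := rep_ringP x.
by rewrite opprB !chi_diff // opprB.
Qed.

Lemma chiB x y s : s \in G -> chi (x - y) s = chi x s - chi y s.
Proof. by move=> Gs; rewrite chiD // chiN. Qed.

Lemma chi1 s : s \in G -> chi 1 s = 1.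
Proof. by move=> Gs; rewrite -(rep_class1 F G) chi_class //= mxtrace1. Qed.

Lemma chi0 s : s \in G -> chi 0 s = 0.
Proof. by move=> Gs; rewrite -(rep_class0 F G) chi_class //= mxtrace1. Qed.

Lemma chiM x y s : s \in G -> chi (x * y) s = chi x s * chi y s.
Proof.
move=> Gs; have [A [B ->]] := rep_ringP x; have [C [D ->]] := rep_ringP y.
have -> : (rep_class A - rep_class B) * (rep_class C - rep_class D) =
  rep_class (dadd_grepr (prod_grepr A C) (prod_grepr B D)) -
  rep_class (dadd_grepr (prod_grepr A D) (prod_grepr B C)).
  by rewrite !rep_classD !rep_classM; ring.
by rewrite !chi_diff // !mxtrace_block !mxtrace_prod; ring.
Qed.

Lemma chi_sum (I : Type) (r : seq I) (P : pred I) (E : I -> rep_ring F G) s :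
  s \in G -> chi (\sum_(i <- r | P i) E i) s = \sum_(i <- r | P i) chi (E i) s.
Proof.
move=> Gs; apply: (big_morph (chi^~ s)); last exact: chi0.
by move=> x y /=; apply: chiD.
Qed.

Lemma chiMn x m s : s \in G -> chi (x *+ m) s = chi x s *+ m.
Proof.
move=> Gs; elim: m => [|m IHm]; first by rewrite chi0.
by rewrite !mulrSr chiD // IHm.
Qed.

Lemma chiJ x s t : s \in G -> t \in G -> chi x (s ^ t)%g = chi x s.
Proof.
move=> Gs Gt; have [A [B ->]] := rep_ringP x; rewrite !chi_diff ?groupJ //.
have trJ (C : rep) : \tr (C (s ^ t)%g) = \tr (C s).
  rewrite /conjg repr_mxM ?groupV ?groupM // repr_mxM // mxtrace_mulC.
  by rewrite -mulmxA repr_mxV ?mulmxV ?mulmx1 // repr_mx_unit.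
by rewrite !trJ.
Qed.

Let sG : irrType F G := DecSocleType (regular_repr F G).
Let irr_rep (i : sG) : rep := Representation (irr_repr i).

(** Complete reducibility, read in the representation ring: split off a proper
    submodule and its complement as long as there is one. *)
Lemma rep_class_irr_sum A :
  exists m : sG -> nat, rep_class A = \sum_i rep_class (irr_rep i) *+ m i.
Proof.
have [d] := ubnP (rdegree A); elim: d => // d IHd in A *.
rewrite ltnS => leAd.
have [A0|A_gt0] := posnP (rdegree A).
  exists (fun=> 0%N); rewrite big1 => [|i _]; last by rewrite mulr0n.
  rewrite -(rep_class0 F G); apply: rep_class_rsim.
  case: A A0 {leAd} => m rA /= m0; rewrite {m}m0 in rA *.
  exists 1%:M => // [|s _]; first by rewrite row_free_unit unitmx1.
  by apply/matrixP=> -[].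
have nz1 : 1%:M != 0 :> 'M[F]_(rdegree A) by rewrite -mxrank_eq0 mxrank1 -lt0n.
have [[U /and4P[modU _ nzU ltU]]|simA] := mxnonsimpleP A nz1; last first.
  have irrA : mx_irreducible A.
    by apply/mxsimpleP; split; [apply: mxmodule1 | |].
  exists (fun i => nat_of_bool (i == irr_comp sG A)).
  rewrite (bigD1 (irr_comp sG A)) //= eqxx mulr1n big1 ?addr0; last first.
    by move=> i /negPf->.
  exact/rep_class_rsim/(rsim_irr_comp_pchar sG pchar'_group).
have [W modW defA dxUW] := mx_Maschke_pchar A pchar'_group modU (submx1 U).
pose rU : rep := Representation (submod_repr modU).
pose rW : rep := Representation (submod_repr modW).
have rkA : (\rank U + \rank W)%N = rdegree A.
  by rewrite -(mxdirectP dxUW) defA mxrank1.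
rewrite mxrank1 in ltU.
have [|mU defU] := IHd rU; first exact: leq_trans ltU leAd.
have [|mW defW] := IHd rW.
  apply: leq_trans leAd; have : (0 < \rank U)%N by rewrite lt0n mxrank_eq0.
  by rewrite -(ltn_add2r (\rank W)) add0n rkA.
exists (fun i => (mU i + mW i)%N).
under eq_bigr do rewrite mulrnDr; rewrite big_split /= -defU -defW -rep_classD.
apply: rep_class_rsim; apply: mx_rsim_trans (mx_rsim_sym _) _.
  exact: (rsim_submod1 (mxmodule1 A)).
exact: (@mx_rsim_dadd _ _ _ _ A U W _ rU rW modU modW (mxmodule1 A) defA dxUW
          (mx_rsim_refl _) (mx_rsim_refl _)).
Qed.

Lemma trace_gring_op A (M : 'M[F]_(gcard G)) :
  \tr (gring_op A M) = \sum_i gring_row M 0 i * \tr (A (enum_val i)).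
Proof.
rewrite gring_opE [X in gring_mx _ X]row_sum_delta !linear_sum /=.
apply: eq_bigr => i _; rewrite !linearZ /=. congr (_ * \tr _).
by rewrite /gring_mx /= -rowE rowK mxvecK.
Qed.

(** The central idempotent e_j of the group algebra acts as the identity on the
    j-th irreducible module and as 0 on the others, so its trace on A is the
    multiplicity of that module times its dimension. This trace depends only on
    the character of A, and characteristic 0 recovers the multiplicity. *)
Lemma eq_chi_rep_class A B :
  {in G, forall s, \tr (A s) = \tr (B s)} -> rep_class A = rep_class B.
Proof.
move=> eqAB; have [mA defA] := rep_class_irr_sum A.
have [mB defB] := rep_class_irr_sum B.
suff eqm j : mA j = mB j by rewrite defA defB; apply: eq_bigr => j _; rewrite eqm.
pose e := (Wedderburn_id j : 'M[F]_(gcard G)).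
have mult (C : rep) m : rep_class C = \sum_i rep_class (irr_rep i) *+ m i ->
    \tr (gring_op C e) = (m j * irr_degree j)%:R.
  move=> defC; rewrite trace_gring_op.
  transitivity (\sum_k gring_row e 0 k *
      \sum_i \tr (irr_repr i (enum_val k)) *+ m i).
    apply: eq_bigr => k _; congr (_ * _).
    rewrite -chi_class ?enum_valP // defC chi_sum ?enum_valP //.
    by apply: eq_bigr => i _; rewrite chiMn ?chi_class ?enum_valP.
  transitivity (\sum_i \tr (gring_op (irr_repr i) e) *+ m i).
    under eq_bigr do rewrite mulr_sumr; rewrite exchange_big; apply: eq_bigr => i _.
    rewrite (trace_gring_op (irr_rep i)) -sumrMnl.
    by apply: eq_bigr => k _; rewrite mulrnAr.
  rewrite (bigD1 j) //= op_Wedderburn_id_pchar ?pchar'_group // mxtrace1 big1.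
    by rewrite addr0 natrM mulr_natl.
  move=> i ne_ij; rewrite (@irr_repr'_op0_pchar _ _ _ _ pchar'_group i j).
  - by rewrite mxtrace0 mul0rn.
  - by rewrite eq_sym.
  - exact: Wedderburn_id_mem.
have: (mA j * irr_degree j)%:R = (mB j * irr_degree j)%:R :> F.
  rewrite -(mult A) // -(mult B) // !trace_gring_op.
  by apply: eq_bigr => k _; rewrite eqAB ?enum_valP.
move/eqP; rewrite eqr_nat eqn_pmul2r => [/eqP//|].
exact: irr_degree_gt0.
Qed.

Lemma chi_inj x y : {in G, chi x =1 chi y} -> x = y.
Proof.
have [A [B ->]] := rep_ringP x; have [C [D ->]] := rep_ringP y => eqxy.
apply/eqP; rewrite subr_eq addrAC eq_sym subr_eq -!rep_classD; apply/eqP.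
apply: eq_chi_rep_class => s Gs; rewrite !mxtrace_block.
have := eqxy s Gs; rewrite !chi_diff // => /eqP.
by rewrite subr_eq addrAC eq_sym subr_eq => /eqP.
Qed.

(** The average of H is the projector onto the H-invariants, whose trace is its
    rank. *)
Lemma sum_trace_subgroup A (H : {group gT}) :
  H \subset G -> exists m : nat, \sum_(s in H) \tr (A s) = (m * #|H|)%:R.
Proof.
move=> sHG; have Hnz : #|H|%:R != 0 :> F by rewrite pnatr_eq0 -lt0n cardG_gt0.
pose P := #|H|%:R^-1 *: \sum_(s in H) A s.
have PP : P *m P = P.
  rewrite -scalemxAl -scalemxAr; congr (_ *: _).
  rewrite mulmx_suml scaler_sumr.
  transitivity (#|H|%:R^-1 *: \sum_(s in H) \sum_(t in H) A t).
    rewrite scaler_sumr; apply: eq_bigr => s Hs.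
    rewrite mulmx_sumr; congr (_ *: _).
    rewrite [RHS](reindex_inj (mulgI s)) /=; apply: eq_big => t.
      by rewrite groupMl.
    by move=> Ht; rewrite repr_mxM ?(subsetP sHG).
  by rewrite sumr_const -scaler_nat scalerA mulVf ?scale1r.
exists (\rank P); rewrite natrM -(trace_idempotent PP) linearZ linear_sum /=.
by rewrite mulrAC mulVf ?mul1r.
Qed.

Lemma sum_chi_subgroup x (H : {group gT}) :
  H \subset G -> exists m : int, \sum_(s in H) chi x s = m%:~R * #|H|%:R.
Proof.
move=> sHG; have [A [B ->]] := rep_ringP x.
have [a sumA] := sum_trace_subgroup A sHG.
have [b sumB] := sum_trace_subgroup B sHG.
exists (a%:Z - b%:Z); rewrite (eq_bigr (fun s => \tr (A s) - \tr (B s))).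
  by rewrite sumrB sumA sumB rmorphB /= mulrBl !natrM.
by move=> s Hs; rewrite chi_diff // (subsetP sHG).
Qed.

End Characters.

(** * Exterior powers and principal minors *)

Section PrincipalMinors.

Variable R : comNzRingType.

(** Sylvester's identity, from the two block triangular factorizations of
    block_mx 1 (- X) Y 1. *)
Lemma det_1add_mulmxC m k (X : 'M[R]_(m, k)) (Y : 'M[R]_(k, m)) :
  \det (1%:M + X *m Y) = \det (1%:M + Y *m X).
Proof.
have L : block_mx 1%:M (- X) Y 1%:M =
    block_mx 1%:M 0 Y 1%:M *m block_mx 1%:M (- X) 0 (1%:M + Y *m X).
  rewrite mulmx_block !(mulmx1, mul1mx, mul0mx, mulmx0, addr0, add0r).
  by rewrite mulmxN addrC addrK.
have U : block_mx 1%:M (- X) Y 1%:M =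
    block_mx (1%:M + X *m Y) (- X) 0 1%:M *m block_mx 1%:M 0 Y 1%:M.
  rewrite mulmx_block !(mulmx1, mul1mx, mul0mx, mulmx0, addr0, add0r).
  by rewrite mulNmx addrK.
have := congr1 determinant U; rewrite L !det_mulmx !det_lblock !det_ublock.
by rewrite !det1 !mul1r !mulr1.
Qed.

(** Replacing the rows outside T by those of the identity turns principal minors
    into determinants of a fixed size, which avoids reordering the indices. *)
Definition row_restrict d (T : {set 'I_d}) (A : 'M[R]_d) : 'M[R]_d :=
  \matrix_(i, j) if i \in T then A i j else (i == j)%:R.

(** The restricted matrix is 1 + E (A_t - 1_t), where E has for columns the
    basis vectors indexed by t and the index t selects rows; exchanging the two
    factors leaves a determinant of size k. *)
Lemma det_row_restrict k d (t : k.-tuple 'I_d) (A : 'M[R]_d) :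
  injective (tnth t) ->
  \det (row_restrict [set x in t] A) = \det (mxsub (tnth t) (tnth t) A).
Proof.
move=> tinj; pose E : 'M[R]_(d, k) := \matrix_(i, a) (tnth t a == i)%:R.
transitivity (\det (1%:M + E *m rowsub (tnth t) (A - 1%:M))).
  congr (\det _); apply/matrixP=> i j; rewrite !mxE inE.
  have [/tnthP[a ->]|/negP ti] := boolP (i \in t).
    rewrite (bigD1 a) //= big1 => [|b]; last first.
      by rewrite !mxE (inj_eq tinj) => /negPf->; rewrite mul0r.
    by rewrite !mxE eqxx mul1r addr0 addrC subrK.
  rewrite big1 ?addr0 // => a _; rewrite !mxE; case: eqP => [Ei|_].
    by case: ti; rewrite -Ei mem_tnth.
  by rewrite mul0r.
rewrite det_1add_mulmxC; congr (\det _); apply/matrixP=> a b; rewrite !mxE.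
rewrite (bigD1 (tnth t b)) //= big1 => [|i]; last first.
  by rewrite !mxE eq_sym => /negPf->; rewrite mulr0.
by rewrite !mxE eqxx mulr1 addr0 (inj_eq tinj) addrC subrK.
Qed.

Lemma det_1add_row_restrict d (u : R) (A : 'M[R]_d) :
  \det (1%:M + u *: A) = \sum_(T : {set 'I_d}) u ^+ #|T| * \det (row_restrict T A).
Proof.
transitivity (\sum_(s : 'S_d) \sum_(T : {set 'I_d})
    (-1) ^+ s * \prod_i (if i \in T then u * A i (s i) else (i == s i)%:R)).
  apply: eq_bigr => s _; rewrite -big_distrr /= -bigA_distr; congr (_ * _).
  by apply: eq_bigr => i _; rewrite !mxE addrC.
rewrite exchange_big; apply: eq_bigr => T _ /=; rewrite big_distrr /=.
apply: eq_bigr => s _; rewrite mulrCA; congr (_ * _).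
transitivity (\prod_i ((if i \in T then u else 1) * row_restrict T A i (s i))).
  by apply: eq_bigr => i _; rewrite !mxE; case: ifP => _; rewrite ?mul1r.
by rewrite big_split -big_mkcond prodr_const.
Qed.

(** Increasing tuples are the enumerations of the sets of size k. *)
Lemma sum_ext_basis k d (E : {set 'I_d} -> R) :
  \sum_(t in ext_basis k d) E [set x in t] = \sum_(T : {set 'I_d} | #|T| == k) E T.
Proof.
have hinj : {in ext_basis k d &, injective (fun t => [set x in t])}.
  move=> t u Bt Bu /= E1; apply: ext_basis_eq => // x xt.
  by move/setP/(_ x): E1; rewrite !inE xt => /esym.
rewrite -(big_imset E hinj); apply: eq_bigl => T.
apply/imsetP/eqP=> [[t Bt ->]|cT].
  by rewrite cardsE (card_uniqP (ext_basis_uniq Bt)) size_tuple.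
pose f (i : 'I_k) : 'I_d := enum_val (cast_ord (esym cT) i).
have finj : injective f by move=> i j /enum_val_inj /cast_ord_inj.
have [t Bt [s fE]] := sort_ffun finj; exists t => //; apply/setP=> x; rewrite inE.
apply/idP/tnthP=> [Tx|[i ->]].
  exists (s (cast_ord cT (enum_rank_in Tx x))).
  by have := fE (cast_ord cT (enum_rank_in Tx x)); rewrite /f cast_ordK enum_rankK_in.
by have := fE (s^-1%g i); rewrite /= permKV => <-; apply: enum_valP.
Qed.

End PrincipalMinors.

(** Both sides are the sum of the principal minors of size k of A, up to
    sign. *)
Lemma coef_det_1sub_ext (F : fieldType) k d (A : 'M[F]_d) :
  (\det (1%:M - 'X *: map_mx polyC A))`_k = (-1) ^+ k * \tr (ext_mx k A).
Proof.
rewrite -scaleNr det_1add_row_restrict coef_sum.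
have detC T : \det (row_restrict T (map_mx polyC A)) = (\det (row_restrict T A))%:P.
  rewrite -det_map_mx; congr (\det _); apply/matrixP=> i j; rewrite !mxE.
  by case: ifP => // _; rewrite rmorph_nat.
transitivity (\sum_(T : {set 'I_d} | #|T| == k) (-1) ^+ k * \det (row_restrict T A)).
  rewrite [RHS]big_mkcond; apply: eq_bigr => T _; rewrite detC coefMC.
  rewrite -scaleN1r exprZn coefZ coefXn eq_sym.
  by case: eqP => [->|_]; rewrite ?mulr1 // mulr0 mul0r.
rewrite -mulr_sumr -sum_ext_basis; congr (_ * _).
transitivity (\sum_(t in ext_basis k d) \det (mxsub (tnth t) (tnth t) A)).
  by apply: eq_bigr => t Bt; rewrite det_row_restrict //; apply: tnth_ext_basis_inj.
by rewrite big_enum_val; apply: eq_bigr => i _; rewrite mxE.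
Qed.

(** * Determinants of permutations on C^n and on V *)

Section CycleDeterminant.

Variable R : comNzRingType.

(** The two restricted matrices multiply to the restriction to the union. *)
Lemma det_row_restrictU d (B C : {set 'I_d}) (A : 'M[R]_d) :
    (forall i j, i \in B -> j \in C -> A i j = 0) ->
  \det (row_restrict (B :|: C) A) =
  \det (row_restrict B A) * \det (row_restrict C A).
Proof.
move=> A0; rewrite -det_mulmx; congr (\det _); apply/matrixP=> i j; rewrite !mxE inE.
have [Bi|nBi] /= := boolP (i \in B).
  rewrite (bigD1 j) //= big1 => [|l ne_lj]; rewrite !mxE Bi.
    by case: ifP => [Cj|_]; rewrite ?eqxx ?mulr1 ?addr0 // A0 ?mul0r.
  by case: ifP => [Cl|_]; rewrite ?(negPf ne_lj) ?mulr0 // A0 ?mul0r.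
rewrite (bigD1 i) //= big1 => [|l ne_li]; rewrite !mxE (negPf nBi).
  by rewrite eqxx mul1r addr0.
by rewrite eq_sym (negPf ne_li) mul0r.
Qed.

(** In the first column of this circulant matrix only the corner entries are
    nonzero; their cofactors are triangular. *)
Lemma det_1add_cycle m (u : R) : (0 < m)%N ->
  \det (\matrix_(i < m, j < m) ((i == j)%:R + u * (i.+1 %% m == j)%N%:R)) =
  1 - (- u) ^+ m.
Proof.
case: m => // m _; set M := \matrix_(i, j) _.
rewrite (expand_det_col _ 0).
transitivity (\sum_i ((i == 0 :> 'I_m.+1)%:R * cofactor M i 0 +
    (i == ord_max)%:R * (u * cofactor M i 0))).
  apply: eq_bigr => i _; rewrite mxE mulrDl -mulrA; congr (_ + _).
  have -> : ((i.+1 %% m.+1)%N == (0 : 'I_m.+1) :> nat) = (i == ord_max).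
    have := ltn_ord i; rewrite -val_eqE /= leq_eqVlt eqSS.
    case: eqP => [-> _|_ /= lt_im]; first by rewrite modnn.
    by rewrite modn_small.
  by rewrite mulrCA.
rewrite big_split /= (bigD1 0) //= big1 ?addr0 => [|i /negPf->]; last first.
  by rewrite mul0r.
rewrite (bigD1 ord_max) //= big1 ?addr0 => [|i /negPf->]; last by rewrite mul0r.
rewrite !eqxx !mul1r /cofactor !addn0 expr0 mul1r; congr (_ + _).
  rewrite -det_tr det_trig; last first.
    apply/is_trig_mxP=> i j lt_ij; rewrite !mxE -!val_eqE /= /bump !leq0n !add1n eqSS.
    rewrite (_ : (j == i :> nat) = false) ?add0r; last by rewrite gtn_eqF.
    have := ltn_ord j; rewrite -ltnS leq_eqVlt => /orP[/eqP->|lt_jm].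
      by rewrite modnn mulr0.
    by rewrite modn_small // !eqSS gtn_eqF ?mulr0 // ltnS ltnW.
  rewrite big1 // => i _; rewrite !mxE -!val_eqE /= /bump !leq0n !add1n eqxx.
  have := ltn_ord i; rewrite -ltnS leq_eqVlt => /orP[/eqP->|lt_im].
    by rewrite modnn mulr0 addr0.
  by rewrite modn_small // eqSS gtn_eqF ?mulr0 ?addr0.
rewrite det_trig; last first.
  apply/is_trig_mxP=> i j lt_ij; rewrite !mxE -!val_eqE /= /bump leq0n add1n.
  rewrite (leqNgt m) ltn_ord add0n modn_small ?ltnS //.
  by rewrite !ltn_eqF ?mulr0 ?addr0 // ltnS ltnW.
rewrite (eq_bigr (fun=> u)) => [|i _]; last first.
  rewrite !mxE -!val_eqE /= /bump leq0n add1n (leqNgt m) ltn_ord add0n.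
  by rewrite modn_small ?ltnS // eqxx ltn_eqF // mulr1 add0r.
by rewrite prodr_const card_ord -exprNn exprS mulNr opprK.
Qed.

Lemma mem_porbit_perm (T : finType) (s : {perm T}) x y :
  (s x \in porbit s y) = (x \in porbit s y).
Proof. by rewrite -!eq_porbit_mem -{1}[s]expg1 (porbit_perm s 1). Qed.

(** Distinct cycles of s do not interact, so the determinant splits as a product
    over the cycles; listed along a cycle, the matrix is circulant. *)
Lemma det_1add_perm d (u : R) (s : 'S_d) :
  \det (1%:M + u *: perm_mx s) = \prod_(C in porbits s) (1 - (- u) ^+ #|C|).
Proof.
set N : 'M_d := _ + _.
have NE i j : N i j = (i == j)%:R + u * (s i == j)%:R by rewrite !mxE.
have detC C : C \in porbits s -> \det (row_restrict C N) = 1 - (- u) ^+ #|C|.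
  case/imsetP=> x _ -> {C}; set m := #|porbit s x|.
  have m_gt0 : (0 < m)%N by apply/card_gt0P; exists x; apply: porbit_id.
  have sz : size (traject s x m) == m by rewrite size_traject.
  pose t := Tuple sz.
  have tE (a : 'I_m) : tnth t a = iter a s x.
    by rewrite (tnth_nth x) nth_traject.
  have tinj : injective (tnth t) by apply/tuple_uniqP/uniq_traject_porbit.
  have -> : porbit s x = [set y in t] by apply/setP=> y; rewrite inE porbit_traject.
  rewrite det_row_restrict // -det_1add_cycle //.
  congr (\det _); apply/matrixP=> a b; rewrite !mxE (inj_eq tinj).
  congr (_ + _ * (nat_of_bool _)%:R).
  have ltm : (a.+1 %% m < m)%N by rewrite ltn_pmod.
  rewrite (_ : s (tnth t a) = tnth t (Ordinal ltm)); first by rewrite (inj_eq tinj).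
  rewrite !tE /= -iterS; have := ltn_ord a; rewrite leq_eqVlt.
  case/orP=> [/eqP->|lt_am]; last by rewrite modn_small.
  by rewrite modnn iter_porbit.
have detr (r : seq {set 'I_d}) : uniq r -> {subset r <= porbits s} ->
    \det (row_restrict (\bigcup_(C <- r) C) N) = \prod_(C <- r) \det (row_restrict C N).
  elim: r => [|C r IHr] /=.
    rewrite !big_nil => _ _; rewrite -[RHS](det1 _ d); congr (\det _).
    by apply/matrixP=> i j; rewrite !mxE inE.
  case/andP=> Cr r_uniq sCr; rewrite !big_cons -IHr //; last first.
    by move=> D rD; apply: sCr; rewrite inE rD orbT.
  apply: det_row_restrictU => i j Ci.
  rewrite bigcup_seq => /bigcupP[D rD Dj].
  have /imsetP[x _ defC] : C \in porbits s by apply: sCr; rewrite inE eqxx.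
  have /imsetP[y _ defD] : D \in porbits s by apply: sCr; rewrite inE rD orbT.
  have CD : j \notin C.
    apply: contra Cr => Cj; rewrite (_ : C = D) //.
    move: Cj Dj; rewrite defC defD -!eq_porbit_mem => /eqP<- /eqP<-.
    by [].
  rewrite NE (_ : (i == j) = false) ?add0r; last first.
    by apply: contraNF CD => /eqP<-.
  rewrite (_ : (s i == j) = false) ?mulr0 //.
  apply: contraNF CD => /eqP<-; rewrite defC in Ci *.
  by rewrite mem_porbit_perm.
transitivity (\det (row_restrict (\bigcup_(C <- enum (porbits s)) C) N)).
  congr (\det _); apply/matrixP=> i j; rewrite [RHS]mxE big_enum.
  case: bigcupP => // -[]; exists (porbit s i); last exact: porbit_id.
  by apply: imset_f.
rewrite detr ?enum_uniq // => [|C]; last by rewrite mem_enum.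
by rewrite big_enum; apply: eq_bigr => C; apply: detC.
Qed.

End CycleDeterminant.

(** The equality of dimensions is a propositional hypothesis, because the
    dimension of the reflection representation is given as a rank. *)
Lemma det_intertwine (R : comNzRingType) m d (A : 'M[R]_m) (A' : 'M[R]_d)
    (B : 'M_(m, d)) (C : 'M_(d, m)) :
  m = d -> B *m C = 1%:M -> B *m A' = A *m B -> \det A = \det A'.
Proof.
move=> md; rewrite {m}md in A B C * => BC BA.
have detBC : \det B * \det C = 1 by rewrite -det_mulmx BC det1.
rewrite -[LHS]mulr1 -[RHS]mulr1 -detBC !mulrA -det_mulmx -BA det_mulmx.
by rewrite [\det A' * _]mulrC.
Qed.

Section ReflectionDeterminant.

Variables (F : numFieldType) (n : nat).
Hypothesis n_gt0 : (0 < n)%N.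

Let ones : 'rV[F]_n := const_mx 1.
Let sums : 'cV[F]_n := const_mx 1.

Lemma ones_sums : ones *m sums = n%:R%:M.
Proof.
apply/matrixP=> i j; rewrite !ord1 !mxE (eq_bigr (fun=> 1)) => [|k _]; last first.
  by rewrite !mxE mulr1.
by rewrite sumr_const card_ord eqxx.
Qed.

Lemma rank_sum0_mx : (\rank (sum0_mx F n)).+1 = n.
Proof.
rewrite mxrank_ker (_ : \rank _ = 1%N) ?subn1 ?prednK //.
apply/eqP; rewrite eqn_leq rank_leq_col lt0n mxrank_eq0.
apply/negP=> /eqP/matrixP/(_ (Ordinal n_gt0) 0); rewrite !mxE.
by move/eqP; rewrite oner_eq0.
Qed.

(** C^n is the sum of V and of the line of constant vectors, on which S_n acts
    trivially. *)
Lemma det_1add_perm_refl (u : {poly F}) (s : 'S_n) :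
  \det (1%:M + u *: map_mx polyC (perm_mx s : 'M[F]_n)) =
  \det (1%:M + u *: map_mx polyC (refl_grepr F n s)) * (1 + u).
Proof.
pose W := val_submod (1%:M : 'M_(\rank (sum0_mx F n))).
have W0 : W *m sums = 0 by apply/sub_kermxP; rewrite val_submod1.
have WP : W *m perm_mx s = refl_grepr F n s *m W.
  rewrite /= -[RHS]val_submodE -[submod_repr _ s]mul1mx.
  by rewrite (val_submodJ (sum0_mxmodule F n)) ?inE.
have eP : ones *m perm_mx s = ones.
  by rewrite -[s]invgK -col_permE; apply/matrixP=> i j; rewrite !mxE.
pose B := col_mx W ones.
have /row_freeP[C BC] : row_free B.
  apply: inj_row_free => v; rewrite -[v]hsubmxK mul_row_col => vB.
  have b0 : rsubmx v = 0.
    have := congr1 (mulmx^~ sums) vB.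
    rewrite /= mulmxDl -(mulmxA _ W) -(mulmxA _ ones) W0 mulmx0 add0r mul0mx ones_sums.
    rewrite mul_mx_scalar => /eqP; rewrite scaler_eq0 pnatr_eq0 -leqn0 leqNgt n_gt0.
    by move/eqP.
  move: vB; rewrite b0 mul0mx addr0 -val_submodE => /eqP; rewrite val_submod_eq0.
  by move/eqP->; rewrite row_mx0.
transitivity (\det (block_mx (1%:M + u *: map_mx polyC (refl_grepr F n s)) 0 0
    ((1 + u)%:M : 'M_1))); last by rewrite det_ublock det_scalar1.
symmetry; apply: (det_intertwine (B := map_mx polyC B) (C := map_mx polyC C)).
- by rewrite addn1 rank_sum0_mx.
- by rewrite -map_mxM BC map_mx1.
rewrite map_col_mx mul_col_mx mul_block_col !mul0mx addr0 add0r.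
congr col_mx.
  by rewrite mulmxDr mulmx1 mulmxDl mul1mx -scalemxAl -scalemxAr -!map_mxM WP.
rewrite mulmxDr mulmx1 -scalemxAr -map_mxM eP mul_scalar_mx.
by rewrite scalerDl scale1r.
Qed.

End ReflectionDeterminant.

(** * Products over the cycles of a permutation *)

Section CycleProducts.

Variable n : nat.
Implicit Types (X Y : {poly int}) (s : 'S_n).

Definition cycle_prod X s : {poly int} := \prod_(C in porbits s) (X \Po 'X^#|C|).

Lemma card_porbits_gt0 s C : C \in porbits s -> (0 < #|C|)%N.
Proof. by case/imsetP=> x _ ->; apply/card_gt0P; exists x; apply: porbit_id. Qed.

Lemma sum_card_porbits s : (\sum_(C in porbits s) #|C|)%N = n.
Proof.
have /card_partition <- : partition (porbits s) [set: 'I_n].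
  apply/and3P; split.
  - rewrite /cover; apply/eqP/setP=> x; rewrite inE; apply/bigcupP.
    by exists (porbit s x); rewrite ?imset_f ?porbit_id.
  - apply/trivIsetP=> _ _ /imsetP[x _ ->] /imsetP[y _ ->].
    apply: contraR => /pred0Pn[z /andP[/= zx zy]].
    by move: zx zy; rewrite -!eq_porbit_mem => /eqP<- /eqP<-.
  - by apply/negP=> /card_porbits_gt0; rewrite cards0.
by rewrite cardsT card_ord.
Qed.

Lemma cycle_prodM X Y s : cycle_prod (X * Y) s = cycle_prod X s * cycle_prod Y s.
Proof.
by rewrite /cycle_prod; under eq_bigr do rewrite comp_polyM; rewrite big_split.
Qed.

Lemma cycle_prod_comp a X s :
  cycle_prod (X \Po 'X^a) s = cycle_prod X s \Po 'X^a.
Proof.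
rewrite /cycle_prod rmorph_prod; apply: eq_bigr => C _ /=.
by rewrite -!comp_polyA !comp_Xn_poly -!exprM mulnC.
Qed.

Lemma cycle_prod_mod a Y s :
  exists Z, cycle_prod (1 + 'X^a * Y) s = 1 + 'X^a * Z.
Proof.
rewrite /cycle_prod; elim/big_rec: _ => [|C p sC [Z ->]].
  by exists 0; rewrite mulr0 addr0.
have [m ->] : exists m, #|C| = m.+1.
  by exists #|C|.-1; rewrite prednK // (card_porbits_gt0 sC).
pose Y' := 'X^(m * a) * (Y \Po 'X^(m.+1)).
exists (Y' + Z + 'X^a * Y' * Z).
rewrite comp_polyD comp_polyM comp_polyC comp_Xn_poly -exprM mulSn exprD /Y'.
by ring.
Qed.

Lemma cycle_prod_coef0 X s : X`_0 = 1 -> (cycle_prod X s)`_0 = 1.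
Proof.
move=> X0; rewrite -horner_coef0 horner_prod big1 // => C /card_porbits_gt0 C_gt0.
by rewrite horner_comp hornerXn expr0n eqn0Ngt C_gt0 horner_coef0.
Qed.

End CycleProducts.

(** * Characters of a subring that contains the exterior powers *)

Section SubringCharacters.

Variables (F : numClosedFieldType) (n : nat) (S : {pred rep_ring F [set: 'S_n]%G}).
Hypotheses (n_gt0 : (0 < n)%N) (subS : subring_closed S).
Implicit Types (f g : 'S_n -> F) (p q : 'S_n -> {poly int}) (X Y : {poly int}).

(** As S is a subring, these functions form a ring, to which questions of
    membership in S are transferred. *)
Definition char_of f := exists2 x, x \in S & chi x =1 f.

Lemma eq_char_of f g : f =1 g -> char_of f -> char_of g.
Proof. by move=> fg [x Sx xf]; exists x => // s; rewrite xf fg. Qed.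

Lemma char_of1 : char_of (fun=> 1).
Proof. by case: subS => S1 _ _; exists 1 => // s; rewrite chi1 ?inE. Qed.

Lemma char_ofB f g : char_of f -> char_of g -> char_of (fun s => f s - g s).
Proof.
case: subS => _ SB _ [x Sx xf] [y Sy yg]; exists (x - y); first exact: SB.
by move=> s; rewrite chiB ?inE // xf yg.
Qed.

Lemma char_ofM f g : char_of f -> char_of g -> char_of (fun s => f s * g s).
Proof.
case: subS => _ _ SM [x Sx xf] [y Sy yg]; exists (x * y); first exact: SM.
by move=> s; rewrite chiM ?inE // xf yg.
Qed.

Lemma char_of0 : char_of (fun=> 0).
Proof.
by apply: eq_char_of (char_ofB char_of1 char_of1) => s; rewrite subrr.
Qed.

Lemma char_ofN f : char_of f -> char_of (fun s => - f s).
Proof.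
by move=> Sf; apply: eq_char_of (char_ofB char_of0 Sf) => s; rewrite sub0r.
Qed.

Lemma char_ofD f g : char_of f -> char_of g -> char_of (fun s => f s + g s).
Proof.
move=> Sf /char_ofN Sg; apply: eq_char_of (char_ofB Sf Sg) => s.
by rewrite opprK.
Qed.

Lemma char_of_sum (I : Type) (r : seq I) (P : pred I) (f : I -> 'S_n -> F) :
  (forall i, P i -> char_of (f i)) -> char_of (fun s => \sum_(i <- r | P i) f i s).
Proof.
move=> Sf; elim: r => [|i r IHr].
  by apply: eq_char_of char_of0 => s; rewrite big_nil.
have [Pi|nPi] := boolP (P i).
  by apply: eq_char_of (char_ofD (Sf i Pi) IHr) => s; rewrite big_cons Pi.
by apply: eq_char_of IHr => s; rewrite big_cons (negPf nPi).
Qed.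

Lemma char_of_int (m : int) : char_of (fun=> m%:~R).
Proof.
have natP (k : nat) : char_of (fun=> k%:R).
  elim: k => [|k IHk]; first exact: char_of0.
  by apply: eq_char_of (char_ofD IHk char_of1) => s; rewrite -natr1.
case: m => k; first exact: natP.
by apply: eq_char_of (char_ofN (natP k.+1)) => s; rewrite NegzE rmorphN.
Qed.

(** The truncation at degree D makes the factorization of a power series into an
    infinite product finite. *)
Definition poly_char_of D p :=
  forall i, (i <= D)%N -> char_of (fun s => ((p s)`_i)%:~R).

Lemma eq_poly_char_of D p q : p =1 q -> poly_char_of D p -> poly_char_of D q.
Proof. by move=> pq Sp i iD; apply: eq_char_of (Sp i iD) => s; rewrite pq. Qed.

(** Division of power series: since p has constant term 1, the i-th coefficient
    of q is that of p q minus a combination of lower coefficients of q. *)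
Lemma poly_char_of_cancel D p q :
    (forall s, (p s)`_0 = 1) -> poly_char_of D p ->
  poly_char_of D (fun s => p s * q s) -> poly_char_of D q.
Proof.
move=> p0 Sp Spq i; have [m] := ubnP i; elim: m i => // m IHm i; rewrite ltnS.
move=> le_im iD.
apply: (@eq_char_of (fun s => ((p s * q s)`_i)%:~R -
    \sum_(j < i) ((p s)`_(j.+1))%:~R * ((q s)`_(i - j.+1))%:~R)).
  move=> s; rewrite coefM big_ord_recl p0 mul1r subn0 rmorphD /= rmorph_sum.
  rewrite -[RHS]addr0 -addrA; congr (_ + _); apply/eqP; rewrite subr_eq0; apply/eqP.
  by apply: eq_bigr => j _; rewrite rmorphM.
apply: char_ofB; first exact: Spq.
apply: char_of_sum => j _; apply: char_ofM.
  by apply: Sp; apply: leq_trans iD.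
apply: IHm; last exact: leq_trans (leq_subr _ _) iD.
by apply: leq_trans le_im; have := ltn_ord j; lia.
Qed.

Section Generation.

Hypothesis genS : forall k, (k <= n.-1)%N ->
  rep_class (ext_grepr k (refl_grepr F n)) \in S.

(** For k >= n the exterior power of V is zero. *)
Lemma char_of_ext_refl k : char_of (fun s => \tr (ext_mx k (refl_grepr F n s))).
Proof.
have [le_kn|lt_nk] := leqP k n.-1.
  by exists (rep_class (ext_grepr k (refl_grepr F n))); [apply: genS |
    move=> s; rewrite chi_class ?inE].
apply: eq_char_of char_of0 => s; rewrite /mxtrace big1 // => i _; exfalso.
have := ltn_ord i; rewrite [X in (_ < X)%N]card_ext_basis bin_small //=.
by rewrite -ltnS rank_sum0_mx // -(prednK n_gt0) ltnS.
Qed.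

Lemma cycle_prod_sub1X D : poly_char_of D (cycle_prod (1 - 'X)).
Proof.
pose V s : 'M_(\rank (sum0_mx F n)) := refl_grepr F n s.
pose e s : {poly F} := \det (1%:M - 'X *: map_mx polyC (V s)).
have Se i : char_of (fun s => (e s)`_i).
  apply: (@eq_char_of (fun s => ((-1) ^+ i)%:~R * \tr (ext_mx i (V s)))).
    by move=> s; rewrite coef_det_1sub_ext rmorphXn rmorphN1.
  apply: char_ofM; [exact: char_of_int | exact: char_of_ext_refl].
move=> i _; apply: (@eq_char_of (fun s => (e s * (1 - 'X))`_i)); last first.
  case: i => [|i].
    apply: eq_char_of (Se 0%N) => s.
    by rewrite mulrBr mulr1 coefB coefMX subr0.
  apply: eq_char_of (char_ofB (Se i.+1) (Se i)) => s.
  by rewrite mulrBr mulr1 coefB coefMX.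
move=> s; rewrite /e -scaleNr -det_1add_perm_refl // map_perm_mx det_1add_perm.
have -> : \prod_(C in porbits s) (1 - (- - 'X) ^+ #|C|) =
    map_poly (intr : int -> F) (cycle_prod (1 - 'X) s).
  rewrite rmorph_prod; symmetry; apply: eq_bigr => C _.
  by rewrite opprK comp_polyB comp_polyC comp_polyX /= rmorphB rmorph1 /= map_polyXn.
by rewrite coef_map.
Qed.

Lemma cycle_prod_sub1Xn D a : (0 < a)%N -> poly_char_of D (cycle_prod (1 - 'X^a)).
Proof.
move=> a_gt0 i _; have := @cycle_prod_sub1X i; set p := cycle_prod (1 - 'X) => Sp.
have pE s : cycle_prod (1 - 'X^a) s = p s \Po 'X^a.
  by rewrite -cycle_prod_comp comp_polyB comp_polyC comp_polyX.
have [dv|ndv] := boolP (a %| i)%N.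
  apply: eq_char_of (Sp (i %/ a)%N (leq_div _ _)) => s.
  by rewrite pE coef_comp_poly_Xn // dv.
by apply: eq_char_of char_of0 => s; rewrite pE coef_comp_poly_Xn // (negPf ndv).
Qed.

Lemma cycle_prod_cancel D X Y : X`_0 = 1 -> poly_char_of D (cycle_prod X) ->
  poly_char_of D (cycle_prod (X * Y)) -> poly_char_of D (cycle_prod Y).
Proof.
move=> X0 SX SXY; apply: (@poly_char_of_cancel D (cycle_prod X)) => //.
  by move=> s; apply: cycle_prod_coef0.
by apply: eq_poly_char_of SXY => s; apply: cycle_prodM.
Qed.

Lemma cycle_prod_add1Xn D a : (0 < a)%N -> poly_char_of D (cycle_prod (1 + 'X^a)).
Proof.
move=> a_gt0; apply: (@cycle_prod_cancel D (1 - 'X^a)).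
- by rewrite coefB coef1 coefXn (ltn_eqF a_gt0) subr0.
- exact: cycle_prod_sub1Xn.
rewrite -subr_sqr expr1n -exprM; apply: cycle_prod_sub1Xn.
by rewrite muln_gt0 a_gt0.
Qed.

Lemma polyD1_drop (p : {poly int}) : p = (p`_0)%:P + 'X * drop_poly 1 p.
Proof.
apply/polyP=> -[|i]; rewrite coefD coefC coefXM /= ?addr0 //.
by rewrite coef_drop_poly addn1 add0r.
Qed.

(** Suppose that X is 1 + y u^a + ... Multiplying X by 1 - u^a if y > 0 and by 1
    + u^a if y < 0 brings y closer to 0, and once it is 0 one passes to a + 1.
    When a exceeds D, the truncated product over the cycles is 1. *)
Lemma cycle_prod_poly_char_of D X : X`_0 = 1 -> poly_char_of D (cycle_prod X).
Proof.
suff main m a Y : (0 < a)%N -> (a + m)%N = D.+1 ->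
    poly_char_of D (cycle_prod (1 + 'X^a * Y)).
  move=> X0; rewrite [X]polyD1_drop X0 -['X]expr1.
  by apply: (main D); rewrite ?add1n.
(* m is the number of steps left until a exceeds D. *)
elim: m => [|m IHm] in a Y *.
  rewrite addn0 => _ aD i iD.
  apply: eq_char_of (char_of_int (i == 0%N)%:R) => s.
  have [Z ->] := cycle_prod_mod a Y s.
  by rewrite coefD coef1 coefXnM aD ltnS iD addr0.
move=> a_gt0 aD; have [c] := ubnP (absz Y`_0); elim: c => // c IHc in Y *.
rewrite ltnS => leYc.
have [Y0|Y_neq0] := eqVneq Y`_0 0.
  rewrite [Y]polyD1_drop Y0 add0r mulrA -exprSr.
  by apply: IHm; rewrite // addSnnS.
have coef0 Z : (Y + Z + 'X^a * (Y * Z))`_0 = Y`_0 + Z`_0.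
  by rewrite !coefD coefXnM a_gt0 addr0.
have [Y_gt0|Y_lt0] : (0 < Y`_0) \/ (Y`_0 < 0) by move: Y_neq0; case: ltgtP; auto.
  apply: (@cycle_prod_cancel D (1 - 'X^a)).
  - by rewrite coefB coef1 coefXn (ltn_eqF a_gt0) subr0.
  - exact: cycle_prod_sub1Xn.
  rewrite (_ : _ * _ = 1 + 'X^a * (Y + (- 1) + 'X^a * (Y * (- 1)))); last by ring.
  by apply: IHc; rewrite coef0 coefN coef1; move: leYc Y_gt0; lia.
apply: (@cycle_prod_cancel D (1 + 'X^a)).
- by rewrite coefD coef1 coefXn (ltn_eqF a_gt0) addr0.
- exact: cycle_prod_add1Xn.
rewrite (_ : _ * _ = 1 + 'X^a * (Y + 1 + 'X^a * (Y * 1))); last by ring.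
by apply: IHc; rewrite coef0 coef1; move: leYc Y_lt0; lia.
Qed.

(** Each cycle contributes the leading coefficient -1 to the product of the 1 -
    u^|C|, and the sign of s is (-1)^(n - number of cycles). *)
Lemma char_of_sign : char_of (fun s => (-1) ^+ s).
Proof.
apply: (@eq_char_of (fun s =>
  ((-1) ^+ n)%:~R * ((cycle_prod (1 - 'X) s)`_n)%:~R)); last first.
  by apply: char_ofM; [apply: char_of_int | apply: (@cycle_prod_sub1X n)].
move=> s; rewrite -rmorphM /=.
have -> : (cycle_prod (1 - 'X) s)`_n = (-1) ^+ #|porbits s|.
  have sz m : (0 < m)%N -> size ((1 - 'X) \Po 'X^m : {poly int}) = m.+1.
    move=> m_gt0; rewrite comp_polyB comp_polyC comp_polyX -opprB size_polyN.
    by rewrite size_XnsubC.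
  have nz C : C \in porbits s -> (1 - 'X) \Po 'X^#|C| != 0 :> {poly int}.
    by move=> /card_porbits_gt0 C_gt0; rewrite -size_poly_gt0 sz.
  have -> : (cycle_prod (1 - 'X) s)`_n = lead_coef (cycle_prod (1 - 'X) s).
    rewrite lead_coefE; congr (_`_ _).
    rewrite size_prod //.
    have -> : (\sum_(C in porbits s) size ((1 - 'X) \Po 'X^#|C| : {poly int}) =
               n + #|porbits s|)%N.
      rewrite -[X in (X + _)%N](sum_card_porbits s) -sum1_card -big_split /=.
      by apply: eq_bigr => C /card_porbits_gt0/sz->; rewrite addn1.
    by rewrite -addSn addnK.
  rewrite lead_coef_prod -prodr_const; apply: eq_bigr => C sC.
  rewrite lead_coefE sz ?(card_porbits_gt0 sC) //= comp_polyB comp_polyC comp_polyX.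
  by rewrite coefB coef1 coefXn eqxx (gtn_eqF (card_porbits_gt0 sC)) sub0r.
rewrite -exprD -[X in X%:~R]signr_odd oddD rmorph_sign; congr (_ ^+ (nat_of_bool _)).
by rewrite /odd_perm card_ord.
Qed.

End Generation.
End SubringCharacters.

(** * Colorings *)

Section Colorings.

Variable n : nat.
Local Notation coloring := {ffun 'I_n -> 'I_n}.
Implicit Types (b c d : coloring) (s t : 'S_n).

Definition fixes s c := [forall x, c (s x) == c x].

Lemma fixesP s c : reflect (forall x, c (s x) = c x) (fixes s c).
Proof. exact: 'forall_eqP. Qed.

Definition class_size c (i : 'I_n) := #|[set x | c x == i]|.

(** The shift by 1 makes the color 0 weightless, so that the generating
    polynomial of the colors has constant term 1. *)
Definition color_weight (i : 'I_n) : nat := n.+1 ^ i - 1.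

Definition weight c : nat := \sum_x color_weight (c x).

Lemma eq_digits N r (a b : 'I_r -> nat) :
    (forall i, a i < N)%N -> (forall i, b i < N)%N ->
  (\sum_i a i * N ^ i = \sum_i b i * N ^ i)%N -> a =1 b.
Proof.
elim: r a b => [|r IHr] a b aN bN; first by move=> _ [].
rewrite !big_ord_recl !muln1 => E.
have shift (c : 'I_r.+1 -> nat) : (\sum_(i < r) c (lift ord0 i) * N ^ lift ord0 i =
    (\sum_(i < r) c (lift ord0 i) * N ^ i) * N)%N.
  by rewrite big_distrl; apply: eq_bigr => i _; rewrite /= -mulnA -expnSr.
rewrite !shift in E.
have E0 : a ord0 = b ord0.
  by have := congr1 (modn^~ N) E; rewrite /= ![(_ + _ * N)%N]addnC !modnMDl !modn_small.
have N_gt0 : (0 < N)%N := leq_ltn_trans (leq0n _) (aN ord0).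
move: E; rewrite E0 => /addnI/eqP; rewrite eqn_pmul2r // => /eqP/IHr E1 i.
by case: (unliftP ord0 i) => [j|] -> //; apply: E1 => k.
Qed.

(** No color occurs more than n times, so the numbers of occurrences are the
    digits in base n.+1 of the weight, after the shift by n. *)
Lemma weight_class_size b c : weight b = weight c -> class_size b =1 class_size c.
Proof.
move=> bc; apply: (@eq_digits n.+1) => [i|i|]; rewrite ?ltnS.
- by rewrite -[X in (_ <= X)%N]card_ord max_card.
- by rewrite -[X in (_ <= X)%N]card_ord max_card.
have expand d : (\sum_i class_size d i * n.+1 ^ i = weight d + n)%N.
  rewrite (eq_bigr (fun i => \sum_(x | d x == i) n.+1 ^ i)%N) => [|i _]; last first.
    by rewrite sum_nat_const; congr (_ * _)%N; apply: eq_card => x; rewrite !inE.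
  transitivity (\sum_x n.+1 ^ d x)%N.
    rewrite [RHS](partition_big d xpredT) //=.
    by apply: eq_bigr => i _; apply: eq_bigr => x /eqP->.
  rewrite -[X in (_ + X)%N]card_ord -sum1_card -big_split /=.
  by apply: eq_bigr => x _; rewrite subnK // expn_gt0.
by rewrite !expand bc.
Qed.

Lemma fixes_porbit s c x y : fixes s c -> y \in porbit s x -> c y = c x.
Proof.
move=> /fixesP sc /porbitP[k ->]; rewrite permX.
by elim: k => //= k; rewrite sc.
Qed.

(** Expanding the product amounts to choosing a color for each cycle, that is, a
    coloring constant on the cycles. *)
Lemma cycle_prod_colorings (i0 : 'I_n) s :
  cycle_prod (\sum_i 'X^(color_weight i)) s = \sum_(c | fixes s c) 'X^(weight c).
Proof.
pose elt (C : {set 'I_n}) := odflt i0 [pick x in C].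
have eltP C : C \in porbits s -> porbit s (elt C) = C.
  case/imsetP=> x _ ->; rewrite /elt; case: pickP => [y|/(_ x)].
    by rewrite -eq_porbit_mem => /eqP.
  by rewrite porbit_id.
have memP x : porbit s x \in porbits s by apply: imset_f.
(* A function on all sets of points is made to represent a coloring of the
   cycles by giving it the value i0 on the other sets. *)
pose h (f : {ffun {set 'I_n} -> 'I_n}) : coloring := [ffun x => f (porbit s x)].
pose h' c := [ffun C => if C \in porbits s then c (elt C) else i0].
have hK c : fixes s c -> h (h' c) = c.
  move=> sc; apply/ffunP=> x; rewrite !ffunE memP; apply: (fixes_porbit sc).
  by rewrite porbit_sym -eq_porbit_mem eltP.
rewrite (reindex_onto h h' hK) /cycle_prod.
under eq_bigr => C sC.
  have -> : (\sum_i 'X^(color_weight i) : {poly int}) \Po 'X^#|C| =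
      \sum_i 'X^(color_weight i * #|C|).
    rewrite rmorph_sum; apply: eq_bigr => i _ /=.
    by rewrite comp_Xn_poly -exprM mulnC.
  over.
rewrite (big_distr_big i0); apply: eq_big => [f|f _].
  have -> : fixes s (h f).
    apply/fixesP=> x; rewrite !ffunE; congr (f _); apply/eqP.
    by rewrite eq_porbit_mem mem_porbit_perm porbit_id.
  apply/pffun_onP/eqP=> [[/subsetP supp _]|<-].
    apply/ffunP=> C; rewrite !ffunE; case: ifPn => [/eltP->//|].
    by apply: contraNeq => ne; apply: supp; rewrite inE eq_sym.
  split=> //; apply/subsetP=> C; rewrite inE !ffunE; apply: contraR => /negPf->.
  by [].
rewrite -expr_sum; congr ('X^_); rewrite /weight.
rewrite [RHS](partition_big (porbit s) (mem (porbits s))) //=.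
apply: eq_bigr => C sC.
rewrite (eq_bigr (fun=> color_weight (f C))) => [|x /eqP <-]; last by rewrite ffunE.
rewrite sum_nat_const mulnC; congr (_ * _)%N; apply: eq_card => x.
by rewrite -[RHS]/(porbit s x == C) -(eltP C sC) eq_porbit_mem.
Qed.

End Colorings.

Section ColoringCharacters.

Variables (F : numClosedFieldType) (n : nat) (S : {pred rep_ring F [set: 'S_n]%G}).
Hypotheses (n_gt0 : (0 < n)%N) (subS : subring_closed S).
Hypothesis genS : forall k, (k <= n.-1)%N ->
  rep_class (ext_grepr k (refl_grepr F n)) \in S.

(** The permutation character of S_n on the colorings of weight w, that is, of a
    given content. *)
Definition coloring_char w (s : 'S_n) : nat :=
  #|[set c | (weight c == w) && fixes s c]|.

Lemma char_of_coloring w : char_of S (fun s => (coloring_char w s)%:R).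
Proof.
pose X : {poly int} := \sum_(i < n) 'X^(color_weight i).
have X0 : X`_0 = 1.
  rewrite coef_sum (bigD1 (Ordinal n_gt0)) //= big1 ?addr0 ?coefXn // => i ne_i0.
  rewrite coefXn /color_weight ltn_eqF // subn_gt0 -{1}(expn0 n.+1) ltn_exp2l //.
  by rewrite lt0n -(inj_eq val_inj) in ne_i0 *.
apply: eq_char_of (cycle_prod_poly_char_of n_gt0 subS genS X0 (leqnn w)) => s.
rewrite /X (cycle_prod_colorings (Ordinal n_gt0)) coef_sum.
rewrite (eq_bigr (fun c => (weight c == w)%:R)) => [|c _]; last first.
  by rewrite coefXn eq_sym.
rewrite -natr_sum -big_mkcondr sum1_card rmorph_nat; congr (_%:R).
by apply: eq_card => c; rewrite !inE andbC.
Qed.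

End ColoringCharacters.

(** * Conjugate contents and the Gale-Ryser extremal case *)

Section Fillings.

Variable n : nat.
Local Notation coloring := {ffun 'I_n -> 'I_n}.
Implicit Types (b c d : coloring) (s t g : 'S_n).

(** Pairs of colorings that separate points correspond to matrices of zeros and
    ones, the (i, j) entry telling whether the colors i and j meet. *)
Definition separates d b := injectiveb (fun x => (d x, b x)).

Lemma separatesP d b :
  reflect (forall x y, d x = d y -> b x = b y -> x = y) (separates d b).
Proof.
rewrite /separates.
apply: (iffP (injectiveP _)) => [inj x y dxy bxy|inj x y []]; last exact: inj.
by apply: inj; rewrite dxy bxy.
Qed.

(** If l' is conjugate to the partition of the class sizes, with parts numbered
    from 0, this is the sum of the parts l'_k for k > j; excess thus compares
    the class sizes of two colorings in the dominance order. *)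
Definition excess d j : nat := \sum_i (class_size d i - j.+1).

Definition above b (j : nat) := #|[set x | (j < b x)%N]|.

Lemma above_class b j : above b j = (\sum_(k : 'I_n | j < k) class_size b k)%N.
Proof.
rewrite /above -sum1_card (partition_big b (fun k : 'I_n => j < k)%N) /=; last first.
  by move=> x; rewrite inE.
apply: eq_bigr => k jk; rewrite sum1_card; apply: eq_card => x.
by rewrite !inE unfold_in /= inE; case: eqP => [->|]; rewrite ?jk ?andbF.
Qed.

Definition above_in d b i (j : nat) := #|[set x | (d x == i) && (j < b x)%N]|.

Lemma above_sum d b j : above b j = (\sum_i above_in d b i j)%N.
Proof.
rewrite /above -sum1_card (partition_big d xpredT) //=.
apply: eq_bigr => i _; rewrite sum1_card; apply: eq_card => x.
by rewrite !inE unfold_in /= inE andbC.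
Qed.

(** Gale-Ryser inequality in one class: on it b is injective, and at most j.+1
    values are at most j. *)
Lemma class_size_le_above d b i j :
  separates d b -> (class_size d i - j.+1 <= above_in d b i j)%N.
Proof.
move=> /separatesP inj; rewrite leq_subLR addnC.
pose low := [set x | (d x == i) && (b x <= j)%N].
have -> : class_size d i = (above_in d b i j + #|low|)%N.
  rewrite /class_size -(cardsID [set x | (j < b x)%N]); congr (_ + _)%N.
    by apply: eq_card => x; rewrite !inE.
  by apply: eq_card => x; rewrite !inE -leqNgt andbC.
rewrite leq_add2l -(card_ord j.+1).
pose f x : 'I_j.+1 := inord (b x).
rewrite -(@card_in_imset _ _ f); first exact: max_card.
move=> x y; rewrite !inE => /andP[/eqP dx bx] /andP[/eqP dy by_] /(congr1 val).
by rewrite /= !inordK // => /val_inj; apply: inj; rewrite dx dy.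
Qed.

(** b lists each class of d bijectively by 0, 1, ..., as a Young diagram filled
    by column indices. *)
Definition filling d b := separates d b /\ forall x, (b x < class_size d (d x))%N.

Lemma above_in_filling d b i j :
  filling d b -> above_in d b i j = (class_size d i - j.+1)%N.
Proof.
case=> sep bnd; apply/eqP; rewrite eqn_leq class_size_le_above // andbT.
rewrite -[X in (_ <= X)%N](size_iota j.+1) -(card_ord (size _)).
pose m := class_size d i.
have low x : (d x == i) && (j < b x)%N -> (b x - j.+1 < size (iota j.+1 (m - j.+1)))%N.
  by rewrite size_iota => /andP[/eqP dx jb]; have := bnd x; rewrite dx -/m; lia.
have [|m_gt] := leqP m j.+1.
  move=> m_le; rewrite /above_in (_ : [set x | _] = set0) ?cards0 //.
  by apply/setP=> x; rewrite !inE; apply/negP=> /low; rewrite size_iota; lia.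
rewrite size_iota in low *; rewrite -/m.
have [k mk] : exists k, (m - j.+1 = k.+1)%N by exists (m - j.+1).-1; lia.
rewrite mk in low *; pose f x : 'I_k.+1 := inord (b x - j.+1).
rewrite /above_in -(@card_in_imset _ _ f); first exact: max_card.
move=> x y; rewrite !inE => Px Py /(congr1 val).
rewrite /= !inordK ?low // => E; case/andP: Px Py => /eqP dx jx /andP[/eqP dy jy].
by move/separatesP: sep; apply; [rewrite dx dy | apply: val_inj => /=; lia].
Qed.

Lemma excess_filling d b j : filling d b -> excess d j = above b j.
Proof.
by move=> db; rewrite (above_sum d); apply: eq_bigr => i _; rewrite above_in_filling.
Qed.

Lemma filling_surj d b i (j : 'I_n) :
  filling d b -> (j < class_size d i)%N -> exists x, d x = i /\ b x = j.
Proof.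
move=> db lt_ji.
case: db => /separatesP sep bnd; set m := class_size d i in lt_ji.
pose B := [set x | d x == i]; pose A := [set k : 'I_n | (k < m)%N].
have bAB : [set b x | x in B] = A.
  apply/eqP; rewrite eqEcard; apply/andP; split.
    by apply/subsetP=> _ /imsetP[x + ->]; rewrite !inE /m => /eqP <-; apply: bnd.
  rewrite card_in_imset -/m => [|x y]; last first.
    by rewrite !inE => /eqP dx /eqP dy; apply: sep; rewrite dx dy.
  have [k mk] : exists k, m = k.+1 by exists m.-1; lia.
  rewrite -[#|B|]/m mk -(card_ord k.+1); pose f (x : 'I_n) : 'I_k.+1 := inord x.
  rewrite -(@card_in_imset _ _ f A); first exact: max_card.
  move=> x y; rewrite !inE mk => xk yk /(congr1 val); rewrite /= !inordK //.
  exact: val_inj.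
have : j \in A by rewrite inE.
by rewrite -bAB => /imsetP[x + ->]; rewrite inE => /eqP dx; exists x.
Qed.

(** Both pairs are bijections onto the cells of the same Young diagram. *)
Lemma filling_match d b c e :
    filling d b -> filling c e -> class_size d =1 class_size c ->
  exists g, forall x, d (g x) = c x /\ b (g x) = e x.
Proof.
move=> db [/separatesP sep bnd] eq_size.
have surj x : exists y, (d y == c x) && (b y == e x).
  have [|y [<- <-]] := @filling_surj d b (c x) (e x) db; first by rewrite eq_size.
  by exists y; rewrite !eqxx.
pose f x := xchoose (surj x).
have fP x : d (f x) = c x /\ b (f x) = e x.
  by have /andP[/eqP-> /eqP->] := xchooseP (surj x).
have f_inj : injective f.
  move=> x y fxy; have [dx bx] := fP x; have [dy by_] := fP y.
  by apply: sep; rewrite -?dx -?bx fxy.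
by exists (perm f_inj) => x; rewrite permE.
Qed.

Lemma sum_class_size d : (\sum_i class_size d i = n)%N.
Proof.
rewrite -[RHS]card_ord -sum1_card [RHS](partition_big d xpredT) //=.
by apply: eq_bigr => i _; rewrite sum1dep_card.
Qed.

(** Second differences in j of the excesses count the classes of each size, so
    the class sizes agree up to a permutation of the colors. *)
Lemma eq_excess_class_size c d :
    (forall j, (j < n)%N -> excess c j = excess d j) ->
  exists r : 'S_n, forall i, class_size d (r i) = class_size c i.
Proof.
move=> eq_exc.
have size_le b i : (class_size b i <= n)%N.
  by rewrite -[X in (_ <= X)%N]card_ord max_card.
have {}eq_exc j : (\sum_i (class_size c i - j) = \sum_i (class_size d i - j))%N.
  case: j => [|j].
    under eq_bigr do rewrite subn0; under [RHS]eq_bigr do rewrite subn0.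
    by rewrite !sum_class_size.
  have [/eq_exc//|le_nj] := ltnP j n.
  rewrite !big1 // => i _; apply/eqP; rewrite subn_eq0.
    by rewrite (leq_trans (size_le _ _)) // ltnW.
  by rewrite (leq_trans (size_le _ _)) // ltnW.
have count_gt b j : (\sum_i (j < class_size b i) + \sum_i (class_size b i - j.+1) =
    \sum_i (class_size b i - j))%N.
  by rewrite -big_split; apply: eq_bigr => i _ /=; case: ltnP; lia.
have eq_gt j : (\sum_i (j < class_size c i) = \sum_i (j < class_size d i))%N.
  by have := count_gt c j; have := count_gt d j; rewrite !eq_exc; lia.
have count_eq b k : (\sum_i (class_size b i == k) + \sum_i (k < class_size b i) =
    \sum_i (k <= class_size b i))%N.
  by rewrite -big_split; apply: eq_bigr => i _ /=; case: ltngtP.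
have eq_ge k : (\sum_i (k <= class_size c i) = \sum_i (k <= class_size d i))%N.
  by case: k => // k; apply: eq_gt.
have eq_count k : (\sum_i (class_size c i == k) = \sum_i (class_size d i == k))%N.
  by have := count_eq c k; have := count_eq d k; rewrite eq_gt eq_ge; lia.
pose sizes b := [tuple class_size b i | i < n].
have /tuple_permP[r cr] : perm_eq (sizes c) (sizes d).
  apply/allP=> k _ /=.
  have cE b : count_mem k (sizes b) = (\sum_i (class_size b i == k))%N.
    rewrite count_map -sum1_count big_mkcond big_enum /=.
    by apply: eq_bigr => i _; case: eqP.
  by rewrite !cE eq_count.
have {}cr : sizes c = [tuple tnth (sizes d) (r i) | i < n] by apply: val_inj.
by exists r => i; have := congr1 (fun u => tnth u i) cr; rewrite !tnth_mktuple.
Qed.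

Lemma card_rank_lt c (x : 'I_n) : (#|[set y : 'I_n | (y < x)%N && (c y == c x)]| < n)%N.
Proof.
rewrite -[X in (_ < X)%N]card_ord -cardsT; apply: proper_card.
by apply/properP; split; [apply: subsetT | exists x; rewrite ?inE ?ltnn].
Qed.

(** The rank of a point inside its class: a coloring of the conjugate
    content. *)
Definition level c : coloring := [ffun x => Ordinal (card_rank_lt c x)].

Lemma level_filling c : filling c (level c).
Proof.
split; last first.
  move=> x; rewrite ffunE /=; apply: proper_card; apply/properP; split.
    by apply/subsetP=> y; rewrite !inE => /andP[].
  by exists x; rewrite !inE ?ltnn.
have lt_level (x y : 'I_n) : (x < y)%N -> c x = c y -> (level c x < level c y)%N.
  move=> xy cxy; rewrite !ffunE /=; apply: proper_card; apply/properP; split.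
    by apply/subsetP=> z; rewrite !inE cxy => /andP[/ltn_trans-> ].
  by exists x; rewrite !inE ?ltnn // xy cxy eqxx.
apply/separatesP=> x y cxy lxy; apply: val_inj.
by case: (ltngtP x y) => // [/lt_level|/lt_level]; rewrite cxy lxy ltnn => /(_ erefl).
Qed.

(** A linear statistic of the excesses: strictly monotone for dominance, it
    replaces the partial order by a total one. *)
Definition key d : nat := \sum_(j < n) excess d j.

(** The inequalities excess d j <= above b j = excess c j hold termwise, so that
    the reverse inequality between the sums forces all of them to be
    equalities. *)
Lemma separates_extremal c d b :
    class_size b =1 class_size (level c) -> separates d b -> (key c <= key d)%N ->
  filling d b /\ (forall j, (j < n)%N -> excess c j = excess d j).
Proof.
move=> bl sep le_cd.
have aboveE j : above b j = excess c j.
  rewrite (excess_filling _ (level_filling c)) !above_class.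
  by apply: eq_bigr => k _; rewrite bl.
have exc_le j : (excess d j <= above b j)%N.
  by rewrite (above_sum d); apply: leq_sum => i _; apply: class_size_le_above.
have eq_exc (j : 'I_n) : excess c j = excess d j.
  apply/eqP; rewrite eq_sym eqn_leq -[in X in X && _]aboveE exc_le /=.
  move: le_cd; rewrite /key (bigD1 j) //= [X in (_ <= X)%N](bigD1 j) //=.
  move=> le_cd; rewrite -(leq_add2r (\sum_(i < n | i != j) excess c i)).
  apply: leq_trans le_cd _; rewrite leq_add2l.
  by apply: leq_sum => i _; rewrite -aboveE.
have eq_in i (j : 'I_n) : above_in d b i j = (class_size d i - j.+1)%N.
  apply/eqP; rewrite eq_sym eqn_leq class_size_le_above //=.
  have : above b j = excess d j by rewrite aboveE.
  rewrite (above_sum d) /excess (bigD1 i) //= [X in _ = X -> _](bigD1 i) //=.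
  move=> E; rewrite -(leq_add2r (\sum_(k | k != i) above_in d b k j)) E leq_add2l.
  by apply: leq_sum => k _; apply: class_size_le_above.
split=> [|j jn]; last exact: (eq_exc (Ordinal jn)).
(* A point outside the diagram would exceed the last column of its class. *)
split=> // x; rewrite ltnNge; apply/negP=> le_mb.
have m_gt0 : (0 < class_size d (d x))%N by apply/card_gt0P; exists x; rewrite inE.
have lt_mn : ((class_size d (d x)).-1 < n)%N.
  by rewrite prednK //; apply: leq_trans (ltnW (ltn_ord (b x))).
have := eq_in (d x) (Ordinal lt_mn); rewrite /= prednK // subnn => /eqP.
rewrite cards_eq0 => /eqP/setP/(_ x); rewrite !inE eqxx /=; lia.
Qed.

End Fillings.

(** * Averages over Young subgroups *)

Section YoungSubgroups.

Variable n : nat.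
Local Notation coloring := {ffun 'I_n -> 'I_n}.
Implicit Types (b c d : coloring) (s t g : 'S_n).

Lemma young_group_set c : group_set [set s : 'S_n | fixes s c].
Proof.
apply/group_setP; split=> [|s t]; rewrite !inE.
  by apply/fixesP=> x; rewrite perm1.
by move=> /fixesP sc /fixesP tc; apply/fixesP=> x; rewrite permM tc sc.
Qed.

Canonical young c : {group 'S_n} := Group (young_group_set c).

(** Translation by a transposition in H reverses the signs. *)
Lemma sum_sign_group (R : numDomainType) (H : {group 'S_n}) x y :
  x != y -> tperm x y \in H -> \sum_(s in H) (-1) ^+ s = 0 :> R.
Proof.
move=> ne_xy Hxy; apply/eqP; rewrite -eqNr; apply/eqP.
rewrite [RHS](reindex_inj (mulgI (tperm x y))) -sumrN /=.
apply: eq_big => [s|s _]; first by rewrite groupMl.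
by rewrite odd_mul_tperm ne_xy signr_addb expr1 mulN1r.
Qed.

(** Exchange the sums: b contributes the sum of the signs over the elements
    fixing both d and b. This group is trivial if b separates d, and otherwise
    contains a transposition. *)
Lemma sum_sign_coloring (R : numDomainType) d w :
  \sum_(s in young d) (-1) ^+ s * (coloring_char w s)%:R =
  #|[set b | (weight b == w) && separates d b]|%:R :> R.
Proof.
transitivity (\sum_(b : coloring | weight b == w)
    \sum_(s in young d :&: young b) (-1) ^+ s : R).
  rewrite (eq_bigr (fun s =>
    \sum_(b : coloring | (weight b == w) && fixes s b) (-1) ^+ s)).
    rewrite (exchange_big_dep (fun b : coloring => weight b == w)) /=; last first.
      by move=> s b _ /andP[].
    by apply: eq_bigr => b wb; apply: eq_bigl => s; rewrite !inE wb.
  move=> s _; rewrite sumr_const mulr_natr; congr (_ *+ _).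
  by apply: eq_card => b; rewrite !inE.
rewrite -sum1_card natr_sum.
rewrite [RHS](eq_bigl (fun b => (weight b == w) && separates d b)); last first.
  by move=> b; rewrite inE.
rewrite big_mkcondr; apply: eq_bigr => b _.
have [/separatesP sep|] := boolP (separates d b).
  rewrite (big_pred1 1%g) ?odd_perm1 // => s; rewrite !inE.
  apply/andP/eqP=> [[/fixesP sd /fixesP sb]|->]; last first.
    by split; apply/fixesP=> x; rewrite perm1.
  by apply/permP=> x; rewrite perm1; apply: sep.
case/injectivePn=> x [y ne_xy [dxy bxy]].
apply: (@sum_sign_group _ _ x y) => //.
by rewrite !inE; apply/andP; split; apply/fixesP=> z; case: tpermP => [->|->|].
Qed.

(** Diagonal of the unitriangular pairing: all such b are fillings, hence Young
    c permutes them simply transitively. *)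
Lemma card_separates_level c :
  #|[set b | (weight b == weight (level c)) && separates c b]| = #|young c|.
Proof.
pose act s : coloring := [ffun x => level c (s x)].
have [sep _] := level_filling c.
have weight_act s : weight (act s) = weight (level c).
  rewrite /weight [RHS](reindex_inj (@perm_inj _ s)).
  by apply: eq_bigr => x _; rewrite ffunE.
have act_inj : {in young c &, injective act}.
  move=> s t; rewrite !inE => /fixesP sc /fixesP tc /ffunP st; apply/permP=> x.
  by move/separatesP: sep; apply; [rewrite sc tc | have := st x; rewrite !ffunE].
rewrite -(card_in_imset act_inj); apply: eq_card => b; rewrite inE.
apply/andP/imsetP=> [[/eqP wb sep_b]|[s]].
  have [cb _] := separates_extremal (weight_class_size wb) sep_b (leqnn _).
  have [g gP] := filling_match (level_filling c) cb (frefl _).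
  exists g; first by rewrite inE; apply/fixesP=> x; have [] := gP x.
  by apply/ffunP=> x; rewrite ffunE; have [_ ->] := gP x.
rewrite inE => /fixesP sc ->; rewrite weight_act eqxx; split=> //.
apply/separatesP=> x y cxy; rewrite [act s x]ffunE [act s y]ffunE => lxy.
by apply: (@perm_inj _ s); move/separatesP: sep; apply=> //; rewrite !sc.
Qed.

(** Equality in the Gale-Ryser inequalities makes the classes of c and d have
    the same sizes, so that their Young subgroups are conjugate. *)
Lemma sum_young_conj (R : nmodType) (f : 'S_n -> R) c d b :
    (forall s t, f (s ^ t)%g = f s) ->
    weight b = weight (level c) -> separates d b -> (key c <= key d)%N ->
  \sum_(s in young d) f s = \sum_(s in young c) f s.
Proof.
move=> fJ wb sep le_cd.
have [db eq_exc] := separates_extremal (weight_class_size wb) sep le_cd.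
have [r rP] := eq_excess_class_size eq_exc.
pose rc : coloring := [ffun x => r (c x)].
have size_rc i : class_size rc (r i) = class_size c i.
  by apply: eq_card => x; rewrite !inE ffunE (inj_eq perm_inj).
have rc_level : filling rc (level c).
  have [/separatesP sep_c bnd] := level_filling c; split; last first.
    by move=> x; rewrite [rc x]ffunE size_rc.
  by apply/separatesP=> x y; rewrite [rc x]ffunE [rc y]ffunE => /perm_inj; apply: sep_c.
have [k|g gP] := filling_match db rc_level.
  by rewrite -[k](permKV r) rP size_rc.
rewrite (reindex_inj (conjg_inj g)) /=; apply: eq_big => [s|s _]; last exact: fJ.
rewrite !inE; apply/fixesP/fixesP=> sP x.
  have := sP (g x); rewrite permJ !(gP _).1 ![rc _]ffunE; exact: perm_inj.
by rewrite -[x](permKV g) permJ !(gP _).1 ![rc _]ffunE sP.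
Qed.

Definition porbit_coloring s : coloring := [ffun x => odflt x [pick y in porbit s x]].

Lemma porbit_coloringE s x y :
  (porbit_coloring s x == porbit_coloring s y) = (porbit s x == porbit s y).
Proof.
have mem z : porbit s (porbit_coloring s z) = porbit s z.
  rewrite ffunE; case: pickP => [t|//] /=.
  by rewrite -eq_porbit_mem => /eqP.
apply/eqP/eqP=> [xy|xy]; first by rewrite -(mem x) xy mem.
rewrite !ffunE xy; case: pickP => // /(_ y).
by rewrite porbit_id.
Qed.

Lemma iter_porbit_mod s x j : iter j s x = iter (j %% #|porbit s x|) s x.
Proof.
rewrite {1}(divn_eq j #|porbit s x|) addnC iterD; congr (iter _ _ _).
by elim: (j %/ _)%N => // q IHq; rewrite mulSn addnC iterD iter_porbit.
Qed.

Lemma iter_porbit_eq s t x j k : #|porbit s x| = #|porbit t x| ->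
  iter j s x = iter k s x -> iter j t x = iter k t x.
Proof.
move=> eq_st; rewrite iter_porbit_mod [RHS]iter_porbit_mod => E.
rewrite iter_porbit_mod [RHS]iter_porbit_mod -eq_st; congr (iter _ t x).
have m_gt0 : (0 < #|porbit s x|)%N by rewrite lt0n card_porbit_neq0.
apply/eqP.
rewrite -(nth_uniq x _ _ (uniq_traject_porbit s x)) ?size_traject ?ltn_pmod //.
by rewrite !nth_traject ?ltn_pmod // E.
Qed.

(** Choose a base point in each cycle and send s^k of it to t^k of it. *)
Lemma porbits_conj s t : porbit s =1 porbit t -> exists g, (s ^ g)%g = t.
Proof.
move=> eq_st; pose base x := porbit_coloring s x.
have base_orb x : x \in porbit s (base x).
  rewrite -eq_porbit_mem /base ffunE; case: pickP => [z|//] /=.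
  by rewrite -eq_porbit_mem eq_sym.
have ex x : exists k, x == iter k s (base x).
  by have /porbitP[k xk] := base_orb x; exists k; rewrite {1}xk permX.
pose k x := xchoose (ex x).
have kP x : x = iter (k x) s (base x) := eqP (xchooseP (ex x)).
pose f x := iter (k x) t (base x).
have f_orb x : porbit t (f x) = porbit s x.
  have := base_orb x; rewrite -eq_porbit_mem => /eqP->.
  by rewrite eq_st /f -permX porbit_perm.
have card_eq x : #|porbit s x| = #|porbit t x| by rewrite eq_st.
have f_inj : injective f.
  move=> x y fxy; have bxy : base x = base y.
    by apply/eqP; rewrite porbit_coloringE -!f_orb fxy.
  rewrite (kP x) (kP y) -bxy; apply: (@iter_porbit_eq t s); rewrite ?card_eq //.
  by rewrite {2}bxy; apply: fxy.
exists (perm f_inj); apply/permP=> y; rewrite -[y](permKV (perm f_inj)).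
set x := ((perm f_inj)^-1)%g y; rewrite permJ !permE.
have bx : base (s x) = base x.
  by apply/eqP; rewrite porbit_coloringE eq_porbit_mem mem_porbit_perm porbit_id.
rewrite /f bx -iterS; apply: (@iter_porbit_eq s t); rewrite ?card_eq //.
by rewrite -{1}bx -kP iterS -kP.
Qed.

(** Let Y be the Young subgroup of the partition of the points into the cycles
    of s. Its elements have at least as many cycles as s; f vanishes on those
    having more, by induction, and the others are conjugate to s, so that the
    sum over Y, which is 0, is a positive multiple of f s. *)
Lemma young_sum_eq0 (R : numDomainType) (f : 'S_n -> R) :
    (forall s t, f (s ^ t)%g = f s) ->
  (forall c, \sum_(s in young c) f s = 0) -> forall s, f s = 0.
Proof.
move=> fJ f0 s; have [m] := ubnP (n - #|porbits s|)%N.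
elim: m s => // m IHm s; rewrite ltnS => le_m.
have porbits_le t : (#|porbits t| <= n)%N.
  by rewrite -[X in (_ <= X)%N](card_ord n) leq_imset_card.
pose c := porbit_coloring s.
have young_orb t x : t \in young c -> porbit s (t x) = porbit s x.
  by rewrite inE => /fixesP/(_ x)/eqP; rewrite porbit_coloringE => /eqP.
have young_sub t x y : t \in young c -> y \in porbit t x -> porbit s y = porbit s x.
  move=> ct /porbitP[k ->]; rewrite permX.
  by elim: k => //= k IHk; rewrite young_orb.
have f_young t : t \in young c ->
    f t = if porbits t == porbits s then f s else 0.
  move=> ct; pose h (C : {set 'I_n}) := \bigcup_(x in C) porbit s x.
  have hE x : h (porbit t x) = porbit s x.
    apply/setP=> y; apply/bigcupP/idP=> [[z xz]|xy].
      by rewrite (young_sub t x z).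
    by exists x => //; apply: porbit_id.
  have h_im : h @: porbits t = porbits s.
    by rewrite /porbits -imset_comp; apply: eq_imset => x /=; rewrite hE.
  have [lt_st|le_ts] := ltnP #|porbits s| #|porbits t|.
    rewrite IHm; first by case: eqP lt_st => // ->; rewrite ltnn.
    by have := porbits_le t; move: le_m lt_st; lia.
  have /imset_injP h_inj : #|h @: porbits t| == #|porbits t|.
    by rewrite eqn_leq leq_imset_card h_im.
  have eq_st : porbit s =1 porbit t.
    move=> x; apply/setP=> y; apply/idP/idP=> [xy|xy]; last first.
      by rewrite -eq_porbit_mem (young_sub t x y).
    rewrite -eq_porbit_mem; apply/eqP/h_inj; rewrite ?imset_f // !hE.
    by apply/eqP; rewrite eq_porbit_mem.
  have -> : porbits t = porbits s by apply: eq_imset => x; rewrite eq_st.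
  by rewrite eqxx; have [g <-] := porbits_conj eq_st; rewrite fJ.
have /eqP := f0 c; rewrite (eq_bigr _ f_young) -big_mkcondr sumr_const.
rewrite mulrn_eq0 => /orP[/eqP/card0_eq/(_ s)|/eqP//].
rewrite unfold_in eqxx andbT inE => /fixesP[] x.
by apply/eqP; rewrite porbit_coloringE eq_porbit_mem mem_porbit_perm porbit_id.
Qed.

End YoungSubgroups.

(** * The exterior powers generate *)

Section HooksGenerate.

Variables (F : numClosedFieldType) (n : nat) (S : {pred rep_ring F [set: 'S_n]%G}).
Hypotheses (n_gt0 : (0 < n)%N) (subS : subring_closed S).
Hypothesis genS : forall k, (k <= n.-1)%N ->
  rep_class (ext_grepr k (refl_grepr F n)) \in S.
Local Notation coloring := {ffun 'I_n -> 'I_n}.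

(** Colorings are treated by decreasing key. Correcting the average over young d
    by an integer multiple of the sign times a coloring character does not
    disturb an average over young c already made zero: as key d <= key c, the
    two pair nontrivially only if young c and young d are conjugate, in which
    case the multiple is 0. *)
Lemma young_sweep x (l : seq coloring) : sorted (relpre (@key n) leq) l ->
  exists2 y, y \in S & {in l, forall c, \sum_(s in young c) chi (x - y) s = 0}.
Proof.
elim: l => [|d l IHl] /=.
  move=> _; exists 0 => //; have [S1 SB _] := subS.
  by rewrite -(subrr 1) SB.
rewrite path_sortedE => [/andP[/allP min_d /IHl[y Sy y0]]|]; last first.
  by move=> ? ? ?; apply: leq_trans.
have [m sum_d] := sum_chi_subgroup (x - y) (subsetT (young d)).
set w := weight (level d).
have [u Su chi_u] : char_of S
    (fun s => m%:~R * ((-1) ^+ s * (coloring_char w s)%:R)).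
  apply: char_ofM => //; first exact: char_of_int.
  by apply: char_ofM => //; [apply: char_of_sign | apply: char_of_coloring].
exists (y + u).
  have [S1 SB _] := subS; rewrite -[u]opprK -[- u]sub0r.
  by rewrite !SB // -(subrr 1) SB.
have sum_c c : \sum_(s in young c) chi (x - (y + u)) s =
    \sum_(s in young c) chi (x - y) s -
    m%:~R * #|[set b | (weight b == w) && separates c b]|%:R.
  rewrite -sum_sign_coloring mulr_sumr -sumrB; apply: eq_bigr => s _.
  by rewrite opprD addrA chiB ?inE // chi_u.
move=> c; rewrite inE => /predU1P[->|lc].
  by rewrite sum_c sum_d card_separates_level subrr.
rewrite sum_c y0 // sub0r.
have [->|[b]] := set_0Vmem [set b | (weight b == w) && separates c b].
  by rewrite cards0 mulr0 oppr0.
rewrite inE => /andP[/eqP wb sep_b].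
have := sum_young_conj _ wb sep_b (min_d c lc) => /(_ _ (chi (x - y))) E.
have : m%:~R * #|young d|%:R = 0 :> F.
  by rewrite -sum_d -E ?y0 // => s t; rewrite chiJ ?inE.
move/eqP; rewrite mulf_eq0 [_%:R == 0]pnatr_eq0 eqn0Ngt cardG_gt0 orbF => /eqP->.
by rewrite mul0r oppr0.
Qed.

Lemma hooks_generate x : x \in S.
Proof.
pose l := sort (relpre (@key n) leq) (enum {: coloring}).
have sorted_l : sorted (relpre (@key n) leq) l.
  by apply: sort_sorted => c d; apply: leq_total.
have [y Sy y0] := young_sweep x sorted_l.
suff -> : x = y by [].
apply: chi_inj => s _; apply/eqP; rewrite -subr_eq0 -chiB ?inE //; apply/eqP.
apply: young_sum_eq0 => [t u|c]; first by rewrite chiJ ?inE.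
by apply: y0; rewrite mem_sort mem_enum.
Qed.

End HooksGenerate.

Theorem theorem4p2 (R : realType) (n : nat) (hn : (1 <= n)%N) :
  generates_ring (fun x : rep_ring R[i] [set: 'S_n]%G =>
    exists2 k : nat, (k <= n.-1)%N
      & x = rep_class (ext_grepr k (refl_grepr R[i] n))).
Proof.
move=> S subS genS x; apply: (@hooks_generate R[i] n S) => // k le_k.
by apply: genS; exists k.
Qed.
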